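(* Let $G\subset \mathrm{Diff}_+^2(\mathbb S^1)$ be a finitely generated subgroup which does not preserve any probability measure on $\mathbb S^1$ and satisfies property $(\star)$ or property $(\Lambda\star)$. Let $\Lambda$ be the unique minimal set of $G$. Then $$\dim_{\mathrm H}\Lambda=\sup\left\{\dim_{\mathrm H}\nu:\ \nu\text{ is an ergodic }\mu\text{-stationary measure on }\Lambda,\text{ where }\mu\text{ is a finitely supported probability measure on }G\right\}.$$
   Context: $\mathrm{Diff}_+^2(\mathbb S^1)$ is the group of orientation-preserving $C^2$ circle diffeomorphisms. A minimal set is a nonempty closed $G$-invariant set, minimal for inclusion; it is exceptional if homeomorphic to a Cantor set. A group without finite orbits has a unique minimal set. $\mathrm{NE}=\{x\in\mathbb S^1: g'(x)\le1\ \forall g\in G\}$ is the set of non-expandable points. Property $(\star)$: $G$ acts minimally on $\mathbb S^1$ and for every $x\in\mathrm{NE}$ there exist $g_+,g_-\in G$ with $g_+(x)=g_-(x)=x$ such that $x$ is isolated from the right in the fixed point set $\mathrm{Fix}(g_+)$ and isolated from the left in $\mathrm{Fix}(g_-)$. Property $(\Lambda\star)$: $G$ admits an exceptional minimal set $\Lambda$ and for every $x\in\mathrm{NE}\cap\Lambda$ there exist such $g_+,g_-\in G$ (fixing $x$, with $x$ isolated from the right in $\mathrm{Fix}(g_+)$ and from the left in $\mathrm{Fix}(g_-)$). For a Borel probability measure $\nu$, $\dim_{\mathrm H}\nu=\inf\{\dim_{\mathrm H}E: E\text{ Borel},\ \nu(E)>0\}$. $\nu$ is $\mu$-stationary if $\nu=\int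 f_*\nu\,d\mu(f)$, and ergodic if it is not a nontrivial convex combination of two $\mu$-stationary measures. *)

(* Defs.v *)
From HB Require Import structures.
From mathcomp Require Import all_boot all_order all_algebra generic_quotient.
From mathcomp Require Import all_classical all_reals all_analysis.

Set Implicit Arguments.
Unset Strict Implicit.
Unset Printing Implicit Defensive.

Import Order.TTheory GRing.Theory Num.Theory.
Import numFieldNormedType.Exports.

Local Open Scope classical_set_scope.
Local Open Scope ring_scope.
Local Open Scope quotient_scope.

Section Circle.
Variable R : realType.

Definition eq_mod1 (s t : R) : bool := s - t \is a Num.int.

Lemma eq_mod1_refl : reflexive eq_mod1.
Proof. by move=> s; rewrite /eq_mod1 subrr rpred0. Qed.

Lemma eq_mod1_sym : symmetric eq_mod1.
Proof. by move=> s t; rewrite /eq_mod1 -opprB rpredN. Qed.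

Lemma eq_mod1_trans : transitive eq_mod1.
Proof.
move=> t s u st tu; rewrite /eq_mod1 -(subrK t s) -addrA.
by rewrite rpredD.
Qed.

Definition eq_mod1_equiv := EquivRel eq_mod1 eq_mod1_refl eq_mod1_sym eq_mod1_trans.

(* The circle is R/Z with the quotient topology; its length is normalised to 1,
   which affects neither derivatives nor Hausdorff dimensions. *)
Definition circle : Type := quotient_topology {eq_quot eq_mod1_equiv}.

HB.instance Definition _ := Quotient.on circle.
HB.instance Definition _ := Topological.on circle.
HB.instance Definition _ := Pointed.on circle.

Definition circle_pi (t : R) : circle := \pi_circle t.

Lemma circle_piP (s t : R) :
  circle_pi s = circle_pi t <-> s - t \is a Num.int.
Proof. by split=> [/(@eqmodP _ eq_mod1_equiv)|?]; last exact/(@eqmodP _ eq_mod1_equiv). Qed.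

Definition circle_dist (x y : circle) : R :=
  inf [set r | exists s t, [/\ circle_pi s = x, circle_pi t = y & r = `|s - t|]].

(* Positive [t] moves [x] in the positive direction, i.e. to the right. *)
Definition circle_shift (x : circle) (t : R) : circle := circle_pi (repr x + t).

Definition borel_circle : Type := g_sigma_algebraType (@open circle).

HB.instance Definition _ := Measurable.on borel_circle.

Definition is_lift (g : circle -> circle) (F : R -> R) : Prop :=
  continuous F /\ forall t, circle_pi (F t) = g (circle_pi t).

(* Two continuous lifts differ by an integer constant, so the derivative below
   does not depend on the chosen lift, nor on the chosen representative. *)
Definition circle_lift (g : circle -> circle) : R -> R := get (is_lift g).

Definition circle_deriv (g : circle -> circle) (x : circle) : R :=
  (circle_lift g)^`()%classic (repr x).

Definition C2_real (F : R -> R) : Prop :=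
  (forall k t, (k < 2)%N -> derivable F^`(k)%classic t 1) /\ continuous F^`(2)%classic.

Definition C2_circle (g : circle -> circle) : Prop :=
  exists2 F, is_lift g F & C2_real F.

Definition Diff2_plus : set (circle -> circle) :=
  [set g | C2_circle g /\
    (exists h, [/\ C2_circle h, cancel g h & cancel h g]) /\
    forall x, 0 < circle_deriv g x].

Definition is_group (G : set (circle -> circle)) : Prop :=
  [/\ G id,
      forall f g, G f -> G g -> G (f \o g) &
      forall f, G f -> exists g, [/\ G g, cancel f g & cancel g f]].

Definition finitely_generated (G : set (circle -> circle)) : Prop :=
  exists S : set (circle -> circle),
    [/\ finite_set S, S `<=` G & G = smallest is_group S].

Definition invariant_set (G : set (circle -> circle)) (A : set circle) : Prop :=
  forall g, G g -> g @` A = A.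

Definition minimal_set (G : set (circle -> circle)) (L : set circle) : Prop :=
  [/\ L !=set0, closed L, invariant_set G L &
    forall A, A !=set0 -> closed A -> invariant_set G A -> A `<=` L -> A = L].

Definition homeomorphic_to_Cantor (L : set circle) : Prop :=
  exists (f : cantor_space -> circle) (h : circle -> cantor_space),
    [/\ continuous f, {within L, continuous h}, range f = L & cancel f h].

Definition exceptional_minimal_set (G : set (circle -> circle))
    (L : set circle) : Prop :=
  minimal_set G L /\ homeomorphic_to_Cantor L.

Definition acts_minimally (G : set (circle -> circle)) : Prop :=
  forall x, dense [set g x | g in G].

Definition NE (G : set (circle -> circle)) : set circle :=
  [set x | forall g, G g -> circle_deriv g x <= 1].

Definition Fix (g : circle -> circle) : set circle := [set x | g x = x].

Definition isolated_right (A : set circle) (x : circle) : Prop :=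
  exists2 e : R, 0 < e & forall t, 0 < t < e -> ~ A (circle_shift x t).

Definition isolated_left (A : set circle) (x : circle) : Prop :=
  exists2 e : R, 0 < e & forall t, 0 < t < e -> ~ A (circle_shift x (- t)).

Definition isolated_fixed (G : set (circle -> circle)) (x : circle) : Prop :=
  exists gp gm, [/\ G gp, G gm, gp x = x, gm x = x &
    isolated_right (Fix gp) x /\ isolated_left (Fix gm) x].

Definition property_star (G : set (circle -> circle)) : Prop :=
  acts_minimally G /\ forall x, NE G x -> isolated_fixed G x.

Definition property_Lambda_star (G : set (circle -> circle)) : Prop :=
  exists2 L, exceptional_minimal_set G L &
    forall x, (NE G `&` L) x -> isolated_fixed G x.

Definition preserves_probability (G : set (circle -> circle)) : Prop :=
  exists nu : probability borel_circle R,
    forall g, G g -> forall A : set borel_circle, measurable A ->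
      pushforward nu (g : borel_circle -> borel_circle) A = nu A.

(* [sup set0 = 0], so the empty set has diameter 0. *)
Definition circle_diam (U : set circle) : R :=
  sup [set circle_dist x y | x in U & y in U].

Definition hausdorff_premeasure (s d : R) (E : set circle) : \bar R :=
  ereal_inf [set (\sum_(0 <= i <oo) ((circle_diam (U i)) `^ s)%:E)%E |
    U in [set U : nat -> set circle |
      (forall i, circle_diam (U i) <= d) /\ E `<=` \bigcup_i U i]].

Definition hausdorff_measure (s : R) (E : set circle) : \bar R :=
  ereal_sup [set hausdorff_premeasure s d E | d in [set d : R | 0 < d]].

(* Restricting to [0 < s] does not change the infimum and avoids [0 `^ 0 = 1]. *)
Definition hausdorff_dim (E : set circle) : \bar R :=
  ereal_inf [set s%:E | s in [set s : R | 0 < s /\ hausdorff_measure s E = 0%E]].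

Definition hausdorff_dim_measure (nu : probability borel_circle R) : \bar R :=
  ereal_inf [set hausdorff_dim E |
    E in [set E : set borel_circle | measurable E /\ (0 < nu E)%E]].

(* A finitely supported probability measure is given by its mass function. *)
Definition finitely_supported_probability (G : set (circle -> circle))
    (mu : (circle -> circle) -> R) : Prop :=
  [/\ forall f, 0 <= mu f,
      finite_set [set f | mu f != 0],
      [set f | mu f != 0] `<=` G &
      \sum_(f \in G) mu f = 1].

Definition stationary (G : set (circle -> circle)) (mu : (circle -> circle) -> R)
    (nu : probability borel_circle R) : Prop :=
  forall A : set borel_circle, measurable A ->
    nu A = (\sum_(f \in G)
      (mu f)%:E * pushforward nu (f : borel_circle -> borel_circle) A)%E.

Definition ergodic_stationary (G : set (circle -> circle))
    (mu : (circle -> circle) -> R) (nu : probability borel_circle R) : Prop :=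
  stationary G mu nu /\
  forall (nu1 nu2 : probability borel_circle R) (t : R),
    stationary G mu nu1 -> stationary G mu nu2 -> 0 < t < 1 ->
    (forall A : set borel_circle, measurable A ->
      nu A = (t%:E * nu1 A + (1 - t)%:E * nu2 A)%E) ->
    forall A : set borel_circle, measurable A -> nu1 A = nu2 A.

End Circle.

(* Main.v *)
Require Import Defs.
From HB Require Import structures.
From mathcomp Require Import all_boot all_order all_algebra.
From mathcomp Require Import all_classical all_reals all_analysis.
From mathcomp Require Import measurable_realfun ring lra.

(** A set of full measure bounds the dimension of the measure from above, so the
    point is the opposite inequality: given [0 < s < s' < dim Lambda], to find a
    finitely supported measure on [G] with an ergodic stationary measure on [Lambda]
    of dimension at least [s].  Such a measure is carried by the limit set of an
    iterated function system made of elements of [G], close to [Lambda] in dimension.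

    Everything is done on the line, with the group of all lifts of elements of [G].
    Near a point of [Lambda] which is not in [NE], some element expands.  Near a point
    of [NE], which is an isolated fixed point on either side, one escapes by iterating
    an element that fixes it, and bounded distortion on fundamental domains shows that
    the total derivative is at least 2 at the end and dominates the sum of the
    intermediate ones ([parabolic_escape]).  By compactness and concatenation, at all
    points of [Lambda] but countably many there are words with arbitrarily large
    derivative and with a fixed bound on the ratio of the sum of the intermediate
    derivatives to the last one ([unbounded_expansion]), hence with bounded distortion
    on a ball that the word maps to a fixed scale ([conical_points]).

    The inverses of these words contract finitely many cells into balls of arbitrarily
    small radius [p x] around almost all points [x] of [Lambda].  As the [s]-dimensional
    Hausdorff measure of [Lambda] is infinite, Vitali's covering lemma selects finitely
    many disjoint balls with a large sum of the [p x `^ s].  Minimality provides maps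
    that bring the balls back to one cell, with bounded loss, and one gets finitely
    many contractions of an arc with disjoint images and lower contraction ratios [c i]
    such that the sum of the [c i `^ s] is at least 1 ([exists_contracting_system]).

    Choose weights [p i <= c i `^ s] of sum 1.  The push-forward of Lebesgue measure by
    the digit expansion with these weights is stationary
    ([exists_weighted_stationary]); since the maps contract, it is the only stationary
    measure on the arc, and therefore ergodic ([weighted_stationary_unique]).  A set of
    diameter [w] has mass at most a constant times [w `^ s] because the images are
    separated ([stationary_small_sets]), and the mass distribution principle bounds
    the dimension below by [s] ([stationary_dim_ge]).

    Under property [(Lambda star)] the hypothesis speaks of an exceptional minimal set
    that must be identified with [Lambda]: two distinct minimal sets would have only
    isolated points ([distinct_minimal_isolated]), and a Cantor set has none. *)

Set Implicit Arguments.
Unset Strict Implicit.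
Unset Printing Implicit Defensive.

Import Order.TTheory GRing.Theory Num.Theory.
Import numFieldNormedType.Exports.

Local Open Scope classical_set_scope.
Local Open Scope ring_scope.

(** * Lifts of circle diffeomorphisms *)

Section LineDiffeo.
Context {R : realType}.
Implicit Types (F G : R -> R) (x y t : R).

(** The properties of a lift of a [C^2] circle diffeomorphism that the argument
    uses.  The second derivative enters only through the Lipschitz constant of
    the logarithm of the first one, which is what distortion estimates need. *)
Record line_diffeo F : Prop := LineDiffeo {
  line_diffeo_derivable : forall t, derivable F t 1;
  line_diffeo_gt0 : forall t, 0 < F^`()%classic t;
  line_diffeo_distortion : exists2 M, 0 <= M & forall x y,
    `|ln (F^`()%classic x) - ln (F^`()%classic y)| <= M * `|x - y|;
  line_diffeo_shift1 : forall t, F (t + 1) = F t + 1 }.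

Lemma line_diffeo_is_derive F t : line_diffeo F -> is_derive t 1 F (F^`()%classic t).
Proof.
by move=> dF; rewrite derive1E; apply: derivableP; apply: line_diffeo_derivable.
Qed.

Lemma line_diffeo_continuous F : line_diffeo F -> continuous F.
Proof.
by move=> dF t; apply/differentiable_continuous/derivable1_diffP;
  exact: line_diffeo_derivable.
Qed.

Lemma line_diffeo_MVT F x y : line_diffeo F -> x < y ->
  exists2 z, x < z < y & F y - F x = F^`()%classic z * (y - x).
Proof.
move=> dF xy; have [||z] := @MVT _ F (F^`()%classic) _ _ xy.
- by move=> t _; exact: line_diffeo_is_derive.
- by apply: continuous_subspaceT; exact: line_diffeo_continuous.
by rewrite in_itv /= => zxy e; exists z.
Qed.

Lemma line_diffeo_lt F : line_diffeo F -> {mono F : x y / x < y}.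
Proof.
move=> dF; apply: leW_mono; apply: le_mono => x y xy.
have [z _ e] := line_diffeo_MVT dF xy.
by rewrite -subr_gt0 e mulr_gt0 ?subr_gt0// line_diffeo_gt0.
Qed.

Lemma line_diffeo_le F : line_diffeo F -> {mono F : x y / x <= y}.
Proof. by move=> dF; apply: le_mono => x y; rewrite line_diffeo_lt. Qed.

Lemma line_diffeo_inj F : line_diffeo F -> injective F.
Proof. by move=> dF; apply: inc_inj; exact: line_diffeo_le. Qed.

Lemma line_diffeo_addn F (n : nat) t : line_diffeo F -> F (t + n%:R) = F t + n%:R.
Proof.
move=> dF; elim: n => [|n IH]; first by rewrite !addr0.
by rewrite -natr1 !addrA line_diffeo_shift1// IH.
Qed.

Lemma line_diffeo_addz F (n : int) t : line_diffeo F -> F (t + n%:~R) = F t + n%:~R.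
Proof.
move=> dF; case: n => n; first exact: line_diffeo_addn.
rewrite NegzE mulrNz; apply: (addIr (n.+1%:R)).
by rewrite -line_diffeo_addn// !addrNK.
Qed.

Lemma line_diffeo_derive_addz F (n : int) t : line_diffeo F ->
  F^`()%classic (t + n%:~R) = F^`()%classic t.
Proof.
move=> dF; rewrite !derive1E /derive.
suff -> : (fun h : R => h^-1 *: ((F \o shift (t + n%:~R)) (h *: 1) -
    F (t + n%:~R))) = (fun h => h^-1 *: ((F \o shift t) (h *: 1) - F t)) by [].
apply/funext => h /=; congr (_ *: _).
by rewrite addrA !(line_diffeo_addz _ _ dF) opprD addrACA subrr addr0.
Qed.

(** The derivative is periodic and the Lipschitz bound on its logarithm holds
    over a period, so it stays away from [0] and from infinity. *)
Lemma line_diffeo_bilipschitz F : line_diffeo F ->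
  exists2 k, 0 < k & forall x y,
    k * `|x - y| <= `|F x - F y| /\ `|F x - F y| <= k^-1 * `|x - y|.
Proof.
move=> dF; have [M M0 hM] := line_diffeo_distortion dF.
set a := ln (F^`()%classic 0).
have bnd t : a - M <= ln (F^`()%classic t) <= a + M.
  have := hM (t - (Num.floor t)%:~R) 0.
  rewrite -mulrNz line_diffeo_derive_addz// -/a mulrNz subr0.
  have /andP[f1 f2] := floor_itv t.
  rewrite intrD1 in f2.
  have : `|t - (Num.floor t)%:~R| <= 1 by rewrite ger0_norm; lra.
  move=> /(ler_wpM2l M0); rewrite mulr1 => h1 h2.
  by have := le_trans h2 h1; rewrite ler_norml => /andP[]; lra.
exists (expR (- (`|a| + M))); first exact: expR_gt0.
have bnd' t : expR (- (`|a| + M)) <= F^`()%classic t <= (expR (- (`|a| + M)))^-1.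
  rewrite -expRN opprK -(@lnK _ (F^`()%classic t)) ?posrE ?line_diffeo_gt0//.
  rewrite !ler_expR; have := bnd t.
  have : `|a| <= `|a| by []. rewrite {1}ler_norml; lra.
have main x y : x < y ->
    expR (- (`|a| + M)) * `|x - y| <= `|F x - F y| /\
      `|F x - F y| <= (expR (- (`|a| + M)))^-1 * `|x - y|.
  move=> xy; have [z _ e] := line_diffeo_MVT dF xy.
  rewrite (distrC x) (distrC (F x)) e normrM (gtr0_norm (line_diffeo_gt0 dF z)).
  by have /andP[b1 b2] := bnd' z; split; apply: ler_wpM2r.
move=> x y; case: (ltgtP x y) => [/main//|/main|->].
  by rewrite (distrC x) (distrC (F x)).
by rewrite !subrr normr0 !mulr0.
Qed.

Lemma line_diffeo_opp F : line_diffeo F -> line_diffeo (fun t => - F (- t)) /\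
  forall t, (fun t => - F (- t))^`()%classic t = F^`()%classic (- t).
Proof.
move=> dF.
have dd t : is_derive t 1 (fun t => - F (- t)) (F^`()%classic (- t)).
  have := line_diffeo_is_derive (- t) dF => h.
  have h2 : is_derive t 1 (-%R : R -> R) (-1) by apply: is_deriveN.
  have := @is_derive1_comp _ F (-%R) t _ _ h h2 => h3.
  have := is_deriveN h3.
  by rewrite mulrN1 opprK.
have e t : (fun t => - F (- t))^`()%classic t = F^`()%classic (- t).
  by rewrite derive1E derive_val.
split => //; split.
- by move=> t; have [] := dd t.
- by move=> t; rewrite e line_diffeo_gt0.
- have [M M0 hM] := line_diffeo_distortion dF; exists M => // x y.
  by rewrite !e (le_trans (hM _ _))// -opprD normrN.
- move=> t; have := line_diffeo_shift1 dF (- t - 1).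
  by rewrite addrNK opprD => ->; ring.
Qed.

(** * Words and bounded distortion *)

Implicit Types w : seq (R -> R).

Fixpoint word_map w x := if w is F :: w' then word_map w' (F x) else x.

Fixpoint word_deriv w x :=
  if w is F :: w' then F^`()%classic x * word_deriv w' (F x) else 1.

(** The sum of the derivatives at [x] of all proper prefixes of the word, the
    empty one included.  Up to a bounded factor it is the sum of the lengths of
    the successive images of a short interval around [x], relative to its own. *)
Fixpoint word_sum w x :=
  if w is F :: w' then 1 + F^`()%classic x * word_sum w' (F x) else 0.

Lemma word_deriv_cat w v x :
  word_deriv (w ++ v) x = word_deriv w x * word_deriv v (word_map w x).
Proof. by elim: w x => [x|F w IH x] /=; rewrite ?mul1r// IH mulrA. Qed.

Lemma word_sum_cat w v x : word_sum (w ++ v) x =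
  word_sum w x + word_deriv w x * word_sum v (word_map w x).
Proof.
by elim: w x => [x|F w IH x] /=; rewrite ?mul1r ?add0r// IH mulrDr mulrA addrA.
Qed.

Lemma word_deriv_gt0 w x : (forall F, F \in w -> line_diffeo F) ->
  0 < word_deriv w x.
Proof.
elim: w x => //= F w IH x dw; rewrite mulr_gt0//.
  by apply: line_diffeo_gt0; apply: dw; rewrite mem_head.
by apply: IH => G Gw; apply: dw; rewrite in_cons Gw orbT.
Qed.

Lemma word_sum_ge0 w x : (forall F, F \in w -> line_diffeo F) ->
  0 <= word_sum w x.
Proof.
elim: w x => //= F w IH x dw; rewrite addr_ge0// mulr_ge0//.
  by apply/ltW/line_diffeo_gt0; apply: dw; rewrite mem_head.
by apply: IH => G Gw; apply: dw; rewrite in_cons Gw orbT.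
Qed.

Lemma word_is_derive w x : (forall F, F \in w -> line_diffeo F) ->
  is_derive x 1 (word_map w) (word_deriv w x).
Proof.
elim: w x => [x _|F w IH x dw] /=; first exact: is_derive_id.
rewrite mulrC; apply: (@is_derive1_comp _ (word_map w) F).
  by apply: IH => G Gw; apply: dw; rewrite in_cons Gw orbT.
by apply: line_diffeo_is_derive; apply: dw; rewrite mem_head.
Qed.

Lemma word_derivE w x : (forall F, F \in w -> line_diffeo F) ->
  (word_map w)^`()%classic x = word_deriv w x.
Proof. by move=> dw; rewrite derive1E; have := word_is_derive x dw => ?; rewrite derive_val. Qed.

Lemma word_deriv_addz w n x : (forall F, F \in w -> line_diffeo F) ->
  word_deriv w (x + n%:~R) = word_deriv w x.
Proof.
elim: w x => // F w IH x dw /=.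
have dF := dw F (mem_head _ _).
rewrite line_diffeo_derive_addz// line_diffeo_addz// IH// => G Gw.
by apply: dw; rewrite in_cons Gw orbT.
Qed.

Lemma word_sum_addz w n x : (forall F, F \in w -> line_diffeo F) ->
  word_sum w (x + n%:~R) = word_sum w x.
Proof.
elim: w x => // F w IH x dw /=.
have dF := dw F (mem_head _ _).
rewrite line_diffeo_derive_addz// line_diffeo_addz// IH// => G Gw.
by apply: dw; rewrite in_cons Gw orbT.
Qed.

(** Induction along the word.  If [c] is the distortion accumulated so far then
    [p * expR c] bounds the current distance of the two orbits, where [p] is the
    initial distance times the derivative of the part already read.  As long as
    [c] is at most [ln 2] this is at most [2 * p], so the next letter adds at most
    [2 * M * p] to the distortion, and [word_sum] adds these contributions up. *)
Lemma word_distortion_acc (M : R) w x y (p c : R) : 0 <= M -> 0 <= p -> 0 <= c ->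
  (forall F, F \in w -> line_diffeo F /\ forall s t,
    `|ln (F^`()%classic s) - ln (F^`()%classic t)| <= M * `|s - t|) ->
  `|y - x| <= p * expR c -> c + 2 * M * p * word_sum w x <= ln 2 ->
  `|ln (word_deriv w y) - ln (word_deriv w x)| <= 2 * M * p * word_sum w x.
Proof.
move=> M0; elim: w x y p c => [|F w IH] x y p c p0 c0 dw yx cl /=.
  by rewrite subrr normr0 mulr0.
have [dF hF] := dw F (mem_head _ _).
have dw' G : G \in w -> line_diffeo G /\ forall s t,
    `|ln (G^`()%classic s) - ln (G^`()%classic t)| <= M * `|s - t|.
  by move=> Gw; apply: dw; rewrite in_cons Gw orbT.
have dw'' G : G \in w -> line_diffeo G by move=> /dw'[].
have Fx0 := line_diffeo_gt0 dF x.
rewrite !lnM ?posrE ?line_diffeo_gt0 ?word_deriv_gt0//.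
have S0 := word_sum_ge0 (F x) dw''.
move: cl => /=; rewrite !mulrDr !mulr1 => cl.
have c2 : c <= ln 2.
  apply: le_trans cl; rewrite lerDl addr_ge0// ?mulr_ge0// ltW//.
have ec2 : expR c <= 2 by rewrite -[leRHS]lnK ?posrE// ler_expR.
have near_deriv z : `|z - x| <= `|y - x| ->
    `|ln (F^`()%classic z) - ln (F^`()%classic x)| <= 2 * M * p.
  move=> zx; rewrite (le_trans (hF _ _))//.
  rewrite -mulrA (mulrC 2) -mulrA ler_wpM2l// (le_trans zx)//.
  by rewrite (le_trans yx)// ler_wpM2l.
have Fyx : `|F y - F x| <= F^`()%classic x * p * expR (c + 2 * M * p).
  have [e|yx0] := eqVneq y x.
    by rewrite e subrr normr0 !mulr_ge0// ?expR_ge0// ltW.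
  have [z [zx ->]] : exists z, `|z - x| <= `|y - x| /\
      `|F y - F x| = F^`()%classic z * `|y - x|.
    case: (ltgtP x y) yx0 => // xy _.
      have [z /andP[z1 z2] e] := line_diffeo_MVT dF xy; exists z.
      rewrite e normrM (gtr0_norm (line_diffeo_gt0 dF _)); split => //.
      by rewrite !gtr0_norm ?subr_gt0//; lra.
    have [z /andP[z1 z2] e] := line_diffeo_MVT dF xy; exists z.
    rewrite (distrC (F y)) e normrM (gtr0_norm (line_diffeo_gt0 dF _)) (distrC x).
    split => //.
    by rewrite (distrC z) (distrC y) !gtr0_norm ?subr_gt0//; lra.
  have /near_deriv := zx; rewrite ler_norml => /andP[_ h].
  have {}h : F^`()%classic z <= F^`()%classic x * expR (2 * M * p).
    rewrite -(@lnK _ (F^`()%classic z)) ?posrE ?line_diffeo_gt0//.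
    rewrite -(@lnK _ (F^`()%classic x)) ?posrE ?line_diffeo_gt0//.
    by rewrite -expRD ler_expR; lra.
  rewrite (le_trans (ler_pM (ltW (line_diffeo_gt0 dF z)) _ h yx))//.
  by rewrite expRD; rewrite le_eqVlt; apply/orP; left; apply/eqP; ring.
have := IH (F x) (F y) (F^`()%classic x * p) (c + 2 * M * p) _ _ dw' Fyx.
rewrite mulr_ge0 ?(ltW Fx0)// addr_ge0 ?mulr_ge0// => /(_ isT isT).
have -> : c + 2 * M * p + 2 * M * (F^`()%classic x * p) * word_sum w (F x) =
  c + (2 * M * p + 2 * M * p * (F^`()%classic x * word_sum w (F x))) by ring.
move=> /(_ cl) h.
rewrite opprD addrACA (le_trans (ler_normD _ _))// lerD ?near_deriv//.
by rewrite (le_trans h)//; rewrite le_eqVlt; apply/orP; left; apply/eqP; ring.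
Qed.

(** The derivative of a word varies by at most a factor 2 from its value at the
    centre of a ball of radius inversely proportional to [word_sum] there. *)
Lemma word_distortion (M : R) w x y (p : R) : 0 <= M -> 0 <= p ->
  (forall F, F \in w -> line_diffeo F /\ forall s t,
    `|ln (F^`()%classic s) - ln (F^`()%classic t)| <= M * `|s - t|) ->
  `|y - x| <= p -> 2 * M * p * word_sum w x <= ln 2 ->
  word_deriv w x / 2 <= word_deriv w y <= 2 * word_deriv w x.
Proof.
move=> M0 p0 dw yx h.
have dw'' G : G \in w -> line_diffeo G by move=> /dw[].
have := @word_distortion_acc M w x y p 0 M0 p0 (lexx _) dw.
rewrite expR0 mulr1 add0r => /(_ yx h) /le_trans/(_ h).
rewrite ler_norml => /andP[h1 h2].
have D0 z : 0 < word_deriv w z by rewrite word_deriv_gt0.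
rewrite -(@lnK _ (word_deriv w y)) ?posrE//; apply/andP; split.
  rewrite -[leLHS]lnK ?posrE ?divr_gt0// ler_expR lnM ?posrE// lnV ?posrE//.
  by lra.
by rewrite -[leRHS]lnK ?posrE ?mulr_gt0// ler_expR lnM ?posrE//; lra.
Qed.

End LineDiffeo.

(** * Escape from a parabolic fixed point *)

Section Parabolic.
Context {R : realType}.
Implicit Types (F G : R -> R) (x y t : R).

Lemma word_map_nseq k F x : word_map (nseq k F) x = iter k F x.
Proof. by elim: k x => //= k IH x; rewrite IH -iterSr. Qed.

Lemma word_sum_nseqSr k F x :
  word_sum (nseq k.+1 F) x = word_sum (nseq k F) x + word_deriv (nseq k F) x.
Proof. by rewrite -addn1 nseqD word_sum_cat word_map_nseq /= mulr0 addr0 mulr1. Qed.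

Lemma nseq_line_diffeo k F : line_diffeo F ->
  forall G, G \in nseq k F -> line_diffeo G.
Proof. by move=> dF G /nseqP[->]. Qed.

Section FundamentalDomains.
Variables (F G : R -> R) (x a M : R).
Hypotheses (dF : line_diffeo F) (FK : cancel F G) (GK : cancel G F).
Hypotheses (Fx : F x = x) (xa : x < a) (Fgt : forall t, x < t <= a -> t < F t).
Hypotheses (M0 : 0 <= M) (hM : forall s t,
  `|ln (F^`()%classic s) - ln (F^`()%classic t)| <= M * `|s - t|).

Let b k := iter k G a.
Let d k := b k - b k.+1.
Let D k y := word_deriv (nseq k F) y.

Let Glt : {mono G : u v / u < v}.
Proof. by move=> u v; rewrite -(line_diffeo_lt dF) !GK. Qed.

Let Gx : G x = x. Proof. by rewrite -{1}Fx FK. Qed.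

Let b_itv k : x < b k <= a.
Proof.
elim: k => [|k IH]; first by rewrite /b /= xa lexx.
have /andP[b1 b2] := IH; have aF : a < F a by rewrite Fgt// xa lexx.
rewrite (_ : b k.+1 = G (b k))// -{1}Gx Glt b1 /=.
by rewrite -(line_diffeo_le dF) GK (le_trans b2)// ltW.
Qed.

Let b_lt k : b k.+1 < b k.
Proof.
have /andP[b1 b2] := b_itv k.+1.
by have := Fgt (b_itv k.+1); rewrite {2}/b iterS GK.
Qed.

Let b_le k l : (k <= l)%N -> b l <= b k.
Proof.
move=> kl; rewrite -(subnKC kl); elim: (l - k)%N => [|n IH]; first by rewrite addn0.
by rewrite addnS (le_trans (ltW (b_lt _)))// -/b.
Qed.

Let d_gt0 k : 0 < d k. Proof. by rewrite subr_gt0 b_lt. Qed.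

Let Fb k : F (b k.+1) = b k. Proof. by rewrite /b iterS GK. Qed.

Let iterFb j k : iter j F (b (j + k)%N) = b k.
Proof. by elim: j => // j IH; rewrite iterSr addSn Fb IH. Qed.

Let b_cvg : b @ \oo --> x.
Proof.
have nb : nonincreasing_seq b by move=> k l; exact: b_le.
have lb : has_lbound (range b).
  by exists x => _ [k _ <-]; have /andP[/ltW] := b_itv k.
have cb := nonincreasing_cvgn nb lb.
set l := inf _ in cb.
have xl : x <= l.
  apply: lb_le_inf; first by exists (b 0); exists 0%N.
  by move=> _ [k _ <-]; have /andP[/ltW] := b_itv k.
have la : l <= a by apply: (ge_inf lb); exists 0%N.
suff -> : x = l by [].
apply/eqP; rewrite eq_le xl /= leNgt; apply/negP => xl'.
have /Fgt : x < l <= a by rewrite xl'.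
suff -> : F l = l by rewrite ltxx.
have /cvg_lim <- // : (F \o (fun k => b k.+1)) @ \oo --> F l.
  apply: continuous_cvg; first exact: line_diffeo_continuous.
  by rewrite cvg_shiftS.
have -> : F \o (fun k => b k.+1) = b by apply/funext => k /=; exact: Fb.
exact: cvg_lim.
Qed.

(** The first [j] images of the [k]-th fundamental domain are consecutive
    domains, so that their lengths add up to at most [a - x]: the distortion of
    every iterate on a fundamental domain obeys one common bound. *)
Let D_distortion j k y z : (j <= k)%N -> b k.+1 <= y <= b k -> b k.+1 <= z <= b k ->
  `|ln (D j y) - ln (D j z)| <= M * (b (k.+1 - j) - b k.+1).
Proof.
elim: j k y z => [|j IH] [|k] y z //; rewrite /D ?subn0 ?subrr ?normr0 ?mulr0//.
move=> jk yk zk /=.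
have dw := @nseq_line_diffeo j F dF.
rewrite !lnM ?posrE ?line_diffeo_gt0 ?word_deriv_gt0//.
have Fk u : b k.+2 <= u <= b k.+1 -> b k.+1 <= F u <= b k.
  by move=> /andP[u1 u2]; rewrite -(Fb k.+1) -(Fb k) !(line_diffeo_le dF) u1.
have := IH k (F y) (F z) jk (Fk _ yk) (Fk _ zk); rewrite -/(D j) => h.
rewrite opprD addrACA (le_trans (ler_normD _ _))//.
have -> : M * (b (k.+2 - j.+1) - b k.+2) = M * d k.+1 + M * (b (k.+1 - j) - b k.+1).
  by rewrite subSS /d; ring.
rewrite lerD// (le_trans (hM _ _))// ler_wpM2l// /d ler_norml.
by move: yk zk => /andP[? ?] /andP[? ?]; lra.
Qed.

Let E := expR (M * (a - x)).

(** The [j]-th iterate maps the [k]-th domain onto the one of rank [k - j], hence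
    by bounded distortion its derivative is comparable to the ratio of lengths. *)
Let D_bounds j k y : (j <= k)%N -> b k.+1 <= y <= b k ->
  E^-1 * (d (k - j)%N / d k) <= D j y <= E * (d (k - j)%N / d k).
Proof.
move=> jk yk.
have dw := @nseq_line_diffeo j F dF.
have D0 u : 0 < D j u by apply: word_deriv_gt0.
have [z /andP[z1 z2] e] : exists2 z, b k.+1 < z < b k & d (k - j)%N = D j z * d k.
  have [||z zi e] := @MVT _ (word_map (nseq j F)) (D j) _ _ (b_lt k).
  - by move=> u _; exact: word_is_derive.
  - apply: continuous_subspaceT => u.
    apply/differentiable_continuous/derivable1_diffP.
    by have [] := word_is_derive u dw.
  exists z => //; move: e; rewrite !word_map_nseq.
  rewrite -{1}(subnKC jk) iterFb -[X in iter j F (b X)](subnKC (leqW jk)) iterFb.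
  by rewrite subSn.
have dk0 := d_gt0 k; have dkn : d k != 0 by rewrite gt_eqF.
have -> : d (k - j)%N / d k = D j z by rewrite e mulfK.
have zk : b k.+1 <= z <= b k by rewrite !ltW.
have := D_distortion jk yk zk.
have := @b_itv (k.+1 - j)%N; have := b_itv k.+1 => /andP[b1 b2] /andP[b3 b4].
have : M * (b (k.+1 - j) - b k.+1) <= M * (a - x).
  by apply: ler_wpM2l => //; lra.
move=> h1 /le_trans/(_ h1); rewrite ler_norml => /andP[h2 h3].
rewrite -(@lnK _ (D j y)) ?posrE// -(@lnK _ (D j z)) ?posrE//.
by rewrite /E -expRN -!expRD !ler_expR; lra.
Qed.

(** The lengths of consecutive domains telescope. *)
Let S_bound j k y : (j <= k)%N -> b k.+1 <= y <= b k ->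
  word_sum (nseq j F) y <= E * ((b (k.+1 - j)%N - b k.+1) / d k).
Proof.
move=> + yk; elim: j => [|j IH] jk.
  by rewrite /= ?subn0 subrr mul0r mulr0.
rewrite word_sum_nseqSr (le_trans (lerD (IH (ltnW jk)) (andP (D_bounds (ltnW jk) yk)).2))//.
rewrite -mulrDr -mulrDl ler_wpM2l ?expR_ge0// ler_wpM2r ?invr_ge0 ?(ltW (d_gt0 _))//.
by rewrite subSS /d subSn 1?ltnW//; lra.
Qed.

(** A fixed point that repels on one side yields expansion on that side even when
    the derivative there is 1.  A point of the [k]-th fundamental domain reaches
    the [0]-th one after [k] steps, with a derivative comparable to [d 0 / d k],
    which is large for large [k] since the domains shrink.  The sum of the
    intermediate derivatives is comparable to [(a - x) / d k], hence at most a
    constant times the final derivative. *)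
Lemma parabolic_escape : exists e C, [/\ 0 < e, 0 <= C & forall y, x < y < x + e ->
  exists k, 2 <= word_deriv (nseq k F) y /\
    word_sum (nseq k F) y <= C * word_deriv (nseq k F) y].
Proof.
have E0 : 0 < E by exact: expR_gt0.
have d00 := d_gt0 0.
(* beyond rank [K] the domains are too short for an expansion by less than 2 *)
have [K hK] : exists K, forall k, (K <= k)%N -> b k - x <= (2 * E)^-1 * d 0.
  have /cvgrPdist_le/(_ ((2 * E)^-1 * d 0)) := b_cvg.
  rewrite mulr_gt0 ?invr_gt0 ?mulr_gt0// => /(_ isT)[K _ h].
  exists K => k /h; rewrite distrC ger0_norm//.
  by have /andP[/ltW] := b_itv k; rewrite subr_ge0.
have C0 : 0 <= E * E * ((a - x) / d 0).
  have e0 := ltW E0; have d0 := ltW d00; have ax0 : 0 <= a - x by rewrite subr_ge0 ltW.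
  by rewrite !mulr_ge0 ?invr_ge0.
exists (b K - x), (E * E * ((a - x) / d 0)); split.
- by have /andP[] := b_itv K; rewrite subr_gt0.
- exact: C0.
move=> y /andP[xy]; rewrite addrC subrK => yK.
have [n yn] : exists n, b n <= y.
  have /cvgrPdist_lt/(_ (y - x)) := b_cvg; rewrite subr_gt0 => /(_ xy)[n _ h].
  exists n; have := h n (leqnn n); rewrite distrC => /ltr_normlW /= hh.
  by rewrite ltW//; lra.
have [k [Kk /andP[yk1 yk2]]] : exists k, (K <= k)%N /\ b k.+1 <= y <= b k.
  have ex : exists n, b n <= y by exists n.
  case: (ex_minnP ex) => -[|m] ym mmin.
    by have := b_le (leq0n K); rewrite leNgt (le_lt_trans ym yK).
  have ym' : y < b m by rewrite ltNge; apply/negP => /mmin; rewrite ltnn.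
  exists m; rewrite ym ltW//; split => //.
  rewrite leqNgt; apply/negP => mK; have := b_le mK.
  by rewrite leNgt (le_lt_trans ym yK).
exists k.
have yk : b k.+1 <= y <= b k by rewrite yk1.
have := D_bounds (leqnn k) yk; rewrite subnn => /andP[D1 D2].
have := S_bound (leqnn k) yk; rewrite subSnn => S1.
have dk0 := d_gt0 k.
have bkx := hK k Kk.
have /andP[xb1 _] := b_itv k.+1.
split.
  apply: le_trans D1; rewrite mulrA ler_pdivlMr//.
  rewrite -(ler_pM2l E0) mulVKf ?gt_eqF//.
  have : 2 * E * d k <= 2 * E * ((2 * E)^-1 * d 0).
    apply: ler_wpM2l; first by lra.
    by apply: le_trans bkx; rewrite /d; lra.
  by rewrite mulVKf ?gt_eqF ?mulr_gt0// => ?; lra.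
apply: (le_trans S1).
have b1a : b 1 - b k.+1 <= a - x by have /andP[_] := b_itv 1; lra.
apply: (@le_trans _ _ (E * ((a - x) / d k))).
  apply: ler_wpM2l; first exact: ltW.
  by apply: ler_wpM2r => //; rewrite invr_ge0 ltW.
apply: le_trans (ler_wpM2l C0 D1); rewrite le_eqVlt; apply/orP; left; apply/eqP; field.
by rewrite !gt_eqF.
Qed.

End FundamentalDomains.
End Parabolic.

(** * Expansion along orbits *)

Section Conical.
Context {R : realType}.
Implicit Types (F G H : R -> R) (x y t : R).

(** The Heine-Borel theorem as an induction principle, through which constants
    that are available near each point become uniform. *)
Lemma compact_local_to_global (K : set R) (P : set R -> Prop) :
  compact K -> P set0 -> (forall A B, P A -> P B -> P (A `|` B)) ->
  (forall A B, A `<=` B -> P B -> P A) ->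
  (forall x, K x -> exists2 e : R, 0 < e & P (ball x e)) -> P K.
Proof.
move=> cK P0 PU Psub Ploc.
have /choice[e he] : forall x, exists e : R, K x -> 0 < e /\ P (ball x e).
  move=> x; have [/Ploc[e e0 Pe]|nKx] := pselect (K x); first by exists e.
  by exists 0.
have [s sK Ks] : finite_subset_cover K (fun x => ball x (e x)) K.
  move: cK; rewrite compact_cover; apply => [x _|x Kx].
    exact: ball_open.
  by exists x => //; apply: ballxx; have [] := he x Kx.
have step (r : seq R) : (forall x, x \in r -> K x) ->
    P (\bigcup_(x in [set` r]) ball x (e x)).
  elim: r => [_|x r IH rK]; first by rewrite set_nil bigcup_set0.
  apply: (Psub _ (ball x (e x) `|` \bigcup_(y in [set` r]) ball y (e y))).
    by move=> y [z /=]; rewrite in_cons => /orP[/eqP ->|zr yz]; [left|right; exists z].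
  apply: PU; first by have [] := he x (rK x (mem_head _ _)).
  by apply: IH => y yr; apply: rK; rewrite in_cons yr orbT.
apply: Psub (step (finmap.enum_fset s) _); first exact: Ks.
by move=> x xs; have := sK x xs; rewrite inE.
Qed.

Record lift_group (D : set (R -> R)) : Prop := LiftGroup {
  lift_group_diffeo : forall F, D F -> line_diffeo F;
  lift_group_comp : forall F G, D F -> D G -> D (F \o G);
  lift_group_inv : forall F, D F -> exists G, [/\ D G, cancel F G & cancel G F];
  lift_group_shift : forall n : int, D (fun t => t + n%:~R) }.

(** The bound on [word_sum] makes the distortion of the word bounded on the ball
    around [y] of radius inversely proportional to the derivative, that is, on a
    neighbourhood of [y] whose image has a fixed size. *)
Definition expands (S : seq (R -> R)) (lam C : R) y := exists w : seq (R -> R),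
  [/\ {subset w <= S}, lam <= word_deriv w y & word_sum w y <= C * word_deriv w y].

Lemma expands_weaken (S S' : seq (R -> R)) (lam lam' C C' : R) y :
  (forall F, F \in S -> line_diffeo F) ->
  {subset S <= S'} -> lam' <= lam -> C <= C' ->
  expands S lam C y -> expands S' lam' C' y.
Proof.
move=> dS SS' ll CC [w [wS h1 h2]]; exists w; split.
- by move=> F /wS/SS'.
- exact: le_trans h1.
apply: le_trans h2 _; apply: ler_wpM2r => //; apply/ltW/word_deriv_gt0.
by move=> F /wS/dS.
Qed.

Lemma expands_near_expanded F x : line_diffeo F -> 1 < F^`()%classic x ->
  exists (e lam : R), [/\ 0 < e, 1 < lam & forall y, `|y - x| < e ->
    expands [:: F] lam 1 y].
Proof.
move=> dF Fx1; have [M M0 hM] := line_diffeo_distortion dF.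
set l := ln (F^`()%classic x); have l0 : 0 < l by rewrite ln_gt0.
exists (l / (2 * (M + 1))), (expR (l / 2)).
have l2 : 1 < expR (l / 2) by rewrite expR_gt1 divr_gt0.
split => //; first by rewrite divr_gt0// mulr_gt0//; lra.
move=> y yx.
have Fy : expR (l / 2) <= F^`()%classic y.
  rewrite -(@lnK _ (F^`()%classic y)) ?posrE ?line_diffeo_gt0// ler_expR.
  have := hM y x; rewrite -/l ler_norml => /andP[h _].
  have : M * `|y - x| <= l / 2.
    have : (M + 1) * `|y - x| <= l / 2.
      move: yx; rewrite invfM mulrA => yx.
      by rewrite mulrC -ler_pdivlMr ?ltW//; lra.
    by have := normr_ge0 (y - x); nra.
  by lra.
exists [:: F]; rewrite /= mulr0 addr0 mulr1 mul1r; split => //.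
exact/ltW/(lt_le_trans l2).
Qed.

(** On an interval without fixed points to the right of [x], either [F] or its
    inverse moves all points away from [x]. *)
Lemma parabolic_right F G x (e : R) : line_diffeo F -> line_diffeo G ->
  cancel F G -> cancel G F -> F x = x -> 0 < e ->
  (forall t, x < t < x + e -> F t <> t) ->
  exists H (e' C : R), [/\ H = F \/ H = G, 0 < e', 0 <= C & forall y, x < y < x + e' ->
  exists k, 2 <= word_deriv (nseq k H) y /\
    word_sum (nseq k H) y <= C * word_deriv (nseq k H) y].
Proof.
move=> dF dG FK GK Fx e0 nofix.
pose a := x + e / 2; have xa : x < a by rewrite /a; lra.
have ae : a < x + e by rewrite /a; lra.
have Gx : G x = x by rewrite -{1}Fx FK.
have main U V : line_diffeo U -> line_diffeo V -> cancel U V -> cancel V U ->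
    U x = x -> (forall t, x < t < x + e -> U t <> t) -> a < U a ->
    exists (e' C : R), [/\ 0 < e', 0 <= C & forall y, x < y < x + e' ->
      exists k, 2 <= word_deriv (nseq k U) y /\
        word_sum (nseq k U) y <= C * word_deriv (nseq k U) y].
  move=> dU dV UK VK Ux nf aU.
  have [M M0 hM] := line_diffeo_distortion dU.
  apply: (@parabolic_escape _ U V x a M) => // t /andP[xt ta].
  rewrite ltNge; apply/negP => Utt.
  have [||c] := @IVT _ (fun s => U s - s) t a 0 ta.
  - apply: continuous_subspaceT => s; apply: cvgB; last exact: cvg_id.
    exact: line_diffeo_continuous.
  - by rewrite ge_min le_max subr_le0 Utt/= !subr_ge0 (ltW aU) orbT.
  rewrite in_itv/= => /andP[tc ca] /eqP; rewrite subr_eq0 => /eqP.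
  by apply: nf; rewrite (lt_le_trans xt tc)/= (le_lt_trans ca ae).
have nofixG t : x < t < x + e -> G t <> t.
  by move=> h Gt; apply: (nofix t h); rewrite -{1}Gt GK.
case: (ltgtP a (F a)) => aF.
- by have [e' [C [? ? ?]]] := main F G dF dG FK GK Fx nofix aF; exists F, e', C; split => //; left.
- have aG : a < G a by rewrite -(line_diffeo_lt dF) GK.
  by have [e' [C [? ? ?]]] := main G F dG dF GK FK Gx nofixG aG; exists G, e', C; split => //; right.
by exfalso; apply: (nofix a); rewrite ?xa.
Qed.

Lemma word_opp F k y : line_diffeo F -> let F' := fun t => - F (- t) in
  word_deriv (nseq k F') y = word_deriv (nseq k F) (- y) /\
  word_sum (nseq k F') y = word_sum (nseq k F) (- y).
Proof.
move=> dF /=; have [dF' e] := line_diffeo_opp dF.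
elim: k y => //= k IH y; have [h1 h2] := IH (- F (- y)).
by rewrite e h1 h2 opprK.
Qed.

(** The conjugation by [t |-> - t] exchanges the two sides. *)
Lemma parabolic_left F G x (e : R) : line_diffeo F -> line_diffeo G ->
  cancel F G -> cancel G F -> F x = x -> 0 < e ->
  (forall t, x - e < t < x -> F t <> t) ->
  exists H (e' C : R), [/\ H = F \/ H = G, 0 < e', 0 <= C & forall y, x - e' < y < x ->
  exists k, 2 <= word_deriv (nseq k H) y /\
    word_sum (nseq k H) y <= C * word_deriv (nseq k H) y].
Proof.
move=> dF dG FK GK Fx e0 nofix.
have [dF' eF] := line_diffeo_opp dF; have [dG' eG] := line_diffeo_opp dG.
have [||||H [e' [C [HFG e'0 C0 hH]]]] := @parabolic_right _ _ (- x) e dF' dG' _ _ _ e0.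
- by move=> t; rewrite !opprK FK opprK.
- by move=> t; rewrite !opprK GK opprK.
- by rewrite opprK Fx.
- move=> t /andP[t1 t2] /eqP; rewrite eqr_oppLR => /eqP; apply: nofix.
  by apply/andP; split; lra.
have [H' [H'FG dH' HE]] : exists H', [/\ H' = F \/ H' = G, line_diffeo H' &
    H = (fun t => - H' (- t))].
  by case: HFG => ->; [exists F|exists G]; split => //; [left|right].
rewrite HE in hH; exists H', e', C; split => // y /andP[y1 y2].
have [|k] := hH (- y); first by apply/andP; split; lra.
by have [-> ->] := word_opp k (- y) dH'; rewrite opprK => h; exists k.
Qed.

Section Group.
Variables (D : set (R -> R)) (L : set R).
Hypothesis gD : lift_group D.
Let dD := lift_group_diffeo gD.

Hypothesis Linv : forall F x, D F -> L x -> L (F x).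

Definition parabolic_fixed x := exists F G (e : R),
  [/\ D F /\ D G, F x = x /\ G x = x, 0 < e,
      (forall t, x < t < x + e -> F t <> t) &
      (forall t, x - e < t < x -> G t <> t)].

Definition locally_expandable x :=
  (exists2 F, D F & 1 < F^`()%classic x) \/ parabolic_fixed x.

Lemma expands_punctured_nbhd x : locally_expandable x ->
  exists (S : seq (R -> R)) (e lam C : R), [/\ forall F, F \in S -> D F, 0 < e, 1 < lam, 0 <= C &
    forall y, `|y - x| < e -> y <> x -> expands S lam C y].
Proof.
move=> [[F DF Fx1]|].
  have [e [lam [e0 lam1 h]]] := expands_near_expanded (dD DF) Fx1.
  exists [:: F], e, lam, 1; split => // [G|y yx _]; last exact: h.
  by rewrite inE => /eqP ->.
move=> [F [G [e [[DF DG] [Fx Gx] e0 rF lG]]]].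
have [F' [DF' FK F'K]] := lift_group_inv gD DF.
have [G' [DG' GK G'K]] := lift_group_inv gD DG.
have [H1 [e1 [C1 [H1F e10 C10 h1]]]] :=
  parabolic_right (dD DF) (dD DF') FK F'K Fx e0 rF.
have [H2 [e2 [C2 [H2G e20 C20 h2]]]] :=
  parabolic_left (dD DG) (dD DG') GK G'K Gx e0 lG.
have DH1 : D H1 by case: H1F => ->.
have DH2 : D H2 by case: H2G => ->.
have dS H : H \in [:: H1; H2] -> D H by rewrite !inE => /orP[] /eqP ->.
exists [:: H1; H2], (Num.min e1 e2), 2, (Num.max C1 C2); split => //.
- by rewrite lt_min e10.
- by rewrite ltr1n.
- by rewrite le_max C10.
move=> y; rewrite lt_min => /andP[]; rewrite !ltr_norml => /andP[? ?] /andP[? ?] yx.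
have : (x < y) || (y < x) by rewrite -neq_lt eq_sym; apply/eqP.
case/orP => xy.
  have [|k [k1 k2]] := h1 y; first by rewrite xy; lra.
  exists (nseq k H1); split => //.
    by move=> H /nseqP[-> _]; rewrite !inE eqxx.
  by rewrite (le_trans k2)// ler_wpM2r ?le_max ?lexx// (le_trans _ k1).
have [|k [k1 k2]] := h2 y; first by rewrite xy; lra.
exists (nseq k H2); split => //.
  by move=> H /nseqP[-> _]; rewrite !inE eqxx orbT.
by rewrite (le_trans k2)// ler_wpM2r ?le_max ?lexx ?orbT// (le_trans _ k1).
Qed.

Hypothesis Lclosed : closed L.
Hypothesis Lexp : forall x, L x -> locally_expandable x.

(** Every point of [L] has a punctured neighbourhood on which one expands with
    uniform constants; compactness of [L] modulo the integers leaves a finite set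
    [E] of exceptional points, up to integer translations. *)
Lemma uniform_expansion : exists (S : seq (R -> R)) (lam C : R) (E : seq R),
  [/\ forall F, F \in S -> D F, 1 < lam, 0 <= C &
    forall y, L y -> (forall z n, z \in E -> y <> z + n%:~R) -> expands S lam C y].
Proof.
pose K : set R := `[0, 1]%classic `&` L.
pose P (A : set R) := exists (S : seq (R -> R)) (lam C : R) (E : seq R),
  [/\ forall F, F \in S -> D F, 1 < lam, 0 <= C &
    forall y, A y -> y \notin E -> expands S lam C y].
have [S [lam [C [E [SD lam1 C0 h]]]]] : P K.
  apply: compact_local_to_global.
  - apply: (@subclosed_compact R K `[0, 1]%classic); last by move=> ? [].
      apply: closedI => //; exact: itv_closed.
    exact: segment_compact.
  - by exists [::], 2, 0, [::]; split => //; rewrite ltr1n.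
  - move=> A B [S1 [l1 [C1 [E1 [SD1 l11 C10 h1]]]]] [S2 [l2 [C2 [E2 [SD2 l21 C20 h2]]]]].
    exists (S1 ++ S2), (Num.min l1 l2), (Num.max C1 C2), (E1 ++ E2); split.
    + by move=> F; rewrite mem_cat => /orP[/SD1|/SD2].
    + by rewrite lt_min l11.
    + by rewrite le_max C10.
    + move=> y yAB; rewrite mem_cat negb_or => /andP[yE1 yE2].
      case: yAB => [yA|yB].
        apply: expands_weaken (h1 y yA yE1).
        * by move=> F /SD1/dD.
        * by move=> F FS; rewrite mem_cat FS.
        * by rewrite ge_min lexx.
        * by rewrite le_max lexx.
      apply: expands_weaken (h2 y yB yE2).
      * by move=> F /SD2/dD.
      * by move=> F FS; rewrite mem_cat FS orbT.
      * by rewrite ge_min lexx orbT.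
      * by rewrite le_max lexx orbT.
  - move=> A B AB [S [lam [C [E [? ? ? h]]]]]; exists S, lam, C, E; split => // y /AB.
    exact: h.
  move=> x [_ /Lexp/expands_punctured_nbhd[S [e [lam [C [SD e0 lam1 C0 h]]]]]].
  exists e => //; exists S, lam, C, [:: x]; split => // y.
  rewrite /ball /= distrC => yx; rewrite inE => /eqP yx'; exact: h.
exists S, lam, C, E; split => // y Ly yE.
have dS F : F \in S -> line_diffeo F by move=> /SD/dD.
set n := Num.floor y.
have := floor_itv y; rewrite -/n intrD1 => /andP[ny yn].
have [|| w [wS w1 w2]] := h (y - n%:~R).
- split; first by rewrite /= in_itv /=; apply/andP; split; lra.
  by rewrite -mulrNz; apply: (Linv (lift_group_shift gD (- n))).
- by apply/negP => /(yE _ n); rewrite subrK.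
have dw F : F \in w -> line_diffeo F by move=> /wS/dS.
exists w; split => //; move: w1 w2; rewrite -(word_deriv_addz n _ dw) -(word_sum_addz n _ dw);
  by rewrite subrK.
Qed.

Lemma word_map_group w : (forall F, F \in w -> D F) -> D (word_map w).
Proof.
elim: w => [_|F w IH wD].
  have := lift_group_shift gD 0; congr D; apply/funext => t /=; exact: addr0.
rewrite (_ : word_map _ = word_map w \o F)//; apply: (lift_group_comp gD).
  by apply: IH => G Gw; apply: wD; rewrite in_cons Gw orbT.
by apply: wD; rewrite mem_head.
Qed.

(** Concatenating expanding words gives expansion by powers of [lam].  With
    [C' = C * lam / (lam - 1)] the bound on [word_sum] is reproduced: if [v] is read
    after [w] then the sum for [w ++ v] is at most
    [D_w * (C' + C * D_v) <= C' * D_w * D_v], because [D_v >= lam], where [D_w] and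
    [D_v] are the derivatives.  The process stops only at the countably many points
    that some word sends to an exceptional point. *)
Lemma unbounded_expansion : exists (S : seq (R -> R)) (C : R) (N : set R),
  [/\ forall F, F \in S -> D F, 0 <= C, countable N &
    forall x (B : R), L x -> ~ N x -> expands S B C x].
Proof.
have [S [lam [C [E [SD lam1 C0 h]]]]] := uniform_expansion.
have dS F : F \in S -> line_diffeo F by move=> /SD/dD.
pose N := [set x | exists (w : seq (R -> R)) z (n : int), [/\ {subset w <= S}, z \in E &
  word_map w x = z + n%:~R]].
pose C' := C * lam / (lam - 1).
have C'0 : 0 <= C' by rewrite divr_ge0 ?mulr_ge0//; lra.
exists S, C', N; split => //.
  pose W (i : seq nat) := map (nth id S) i.
  pose N1 (c : seq nat * nat * int) := [set x | {subset W c.1.1 <= S} /\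
    word_map (W c.1.1) x = nth 0 E c.1.2 + c.2%:~R].
  apply: (@sub_countable _ _ _ (\bigcup_(c in setT) N1 c)).
    apply: subset_card_le => x [w [z [n [wS zE e]]]].
    exists ([seq index F S | F <- w], index z E, n) => //.
    have -> : N1 ([seq index F S | F <- w], index z E, n) =
       [set x | {subset w <= S} /\ word_map w x = z + n%:~R].
      rewrite /N1 /= nth_index// /W -map_comp.
      suff -> : [seq (nth id S \o index^~ S) i | i <- w] = w by [].
      by rewrite -[RHS]map_id; apply/eq_in_map => F /wS FS /=; rewrite nth_index.
    by [].
  apply: bigcup_countable => [|c _]; first exact: countableP.
  apply/countable_injP; exists (fun=> 0%N) => x y; rewrite !inE => -[wS e1] [_ e2] _.
  have wD : D (word_map (W c.1.1)) by apply: word_map_group => F /wS/SD.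
  by apply: (line_diffeo_inj (dD wD)); rewrite e1 e2.
move=> x B Lx Nx.
suff pow k : expands S (lam ^+ k) C' x.
  have [k Bk] : exists k, B <= lam ^+ k.
    have lam0 : 0 < lam - 1 by lra.
    pose k := (Num.trunc (`|B| / (lam - 1))).+1.
    exists k.
    have : `|B| / (lam - 1) < k%:R by exact: truncnS_gt.
    rewrite ltr_pdivrMr// => h1.
    have h2 : 1 + (lam - 1) *+ k <= lam ^+ k.
      elim: (k) => [|j IH]; first by rewrite mulr0n addr0 expr0.
      have q := ler_wpM2l (ltW (lt_trans ltr01 lam1)) IH.
      have : 0 <= (lam - 1) * ((lam - 1) *+ j).
        by rewrite mulr_ge0 ?mulrn_wge0// ltW.
      by rewrite exprS mulrSr; move: q; set u := (lam - 1) *+ j; lra.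
    by have := ler_norm B; rewrite -mulr_natl in h2; lra.
  by apply: expands_weaken (pow k).
elim: k => [|k [w [wS w1 w2]]].
  by exists [::]; rewrite /= mulr1 expr0.
have dw F : F \in w -> line_diffeo F by move=> /wS/dS.
have [||v [vS v1 v2]] := h (word_map w x).
- by apply: Linv => //; apply: word_map_group => F /wS/SD.
- by move=> z n zE e; apply: Nx; exists w, z, n.
exists (w ++ v); rewrite word_deriv_cat word_sum_cat; split.
- by move=> F; rewrite mem_cat => /orP[/wS|/vS].
- rewrite exprSr; apply: ler_pM => //; first by rewrite exprn_ge0//; lra.
  by lra.
have D0 := word_deriv_gt0 x dw.
rewrite mulrCA (le_trans (lerD w2 (ler_wpM2l (ltW D0) v2)))//.
set d := word_deriv w x in D0 *; set d' := word_deriv v _ in v1 v2 *.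
rewrite (mulrC C') -mulrDr ler_wpM2l ?(ltW D0)//.
rewrite /C' -(ler_pM2r (_ : 0 < lam - 1)) ?subr_gt0// mulrDl divfK ?gt_eqF ?subr_gt0//.
rewrite [C * lam / (lam - 1) * d']mulrC -[leRHS]mulrA divfK ?gt_eqF ?subr_gt0//.
have : C * (d' - lam) >= 0 by rewrite mulr_ge0// subr_ge0.
by lra.
Qed.

End Group.
End Conical.

(** * Conical points and inverse branches *)

Section Selection.
Context {R : realType}.
Implicit Types (F G H : R -> R) (x y t : R).

Lemma finite_pos_lower_bound n (d : 'I_n -> R) : (forall i, 0 < d i) ->
  exists2 e, 0 < e & forall i, e <= d i.
Proof.
move=> d0; exists (\big[Order.min/1]_i d i); last by move=> i; exact: bigmin_le.
by apply: lt_bigmin => // i _; exact: d0.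
Qed.

Lemma common_distortion (S : seq (R -> R)) : (forall F, F \in S -> line_diffeo F) ->
  exists2 M : R, 0 <= M & forall F, F \in S -> line_diffeo F /\ forall s t,
    `|ln (F^`()%classic s) - ln (F^`()%classic t)| <= M * `|s - t|.
Proof.
elim: S => [_|F S IH dS]; first by exists 0.
have [|M M0 hM] := IH; first by move=> G GS; apply: dS; rewrite in_cons GS orbT.
have dF := dS F (mem_head _ _).
have [M' M'0 hM'] := line_diffeo_distortion dF.
exists (Num.max M M'); first by rewrite le_max M0.
move=> G; rewrite in_cons => /orP[/eqP ->|/hM[dG hG]]; split => // s t.
  by rewrite (le_trans (hM' _ _))// ler_wpM2r// le_max lexx orbT.
by rewrite (le_trans (hG _ _))// ler_wpM2r// le_max lexx.
Qed.

Section Group.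
Variables (D : set (R -> R)) (L : set R).
Hypothesis gD : lift_group D.
Let dD := lift_group_diffeo gD.
Hypothesis Linv : forall F x, D F -> L x -> L (F x).
Hypothesis Lclosed : closed L.
Hypothesis Lexp : forall x, L x -> locally_expandable D x.

(** Outside a countable set, arbitrarily small balls around a point of [L] are
    blown up to a fixed size, the derivative staying within a factor 2 of its value
    at the centre. *)
Lemma conical_points : exists (r : R) (N : set R), [/\ 0 < r, countable N &
  forall x (B : R), L x -> ~ N x -> exists F, [/\ D F, B <= F^`()%classic x &
    forall y, `|y - x| <= r / F^`()%classic x ->
      F^`()%classic x / 2 <= F^`()%classic y <= 2 * F^`()%classic x]].
Proof.
have [S [C [N [SD C0 cN h]]]] := unbounded_expansion gD Linv Lclosed Lexp.
have [|M M0 hM] := @common_distortion S; first by move=> F /SD/dD.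
have ln20 : 0 < ln 2 :> R by rewrite ln_gt0// ltr1n.
pose r := ln 2 / (2 * (M + 1) * (C + 1)) : R.
have r0 : 0 < r by rewrite divr_gt0// !mulr_gt0//; lra.
exists r, N; split => // x B Lx Nx.
have [w [wS w1 w2]] := h x B Lx Nx.
have dw F : F \in w -> line_diffeo F by move=> /wS/SD/dD.
exists (word_map w); rewrite word_derivE//; split => //.
  by apply: (word_map_group gD) => F /wS/SD.
move=> y yx; rewrite word_derivE//.
have D0 := word_deriv_gt0 x dw.
apply: (word_distortion M0 _ _ yx); first by rewrite divr_ge0// ltW.
  by move=> F /wS/hM.
apply: (@le_trans _ _ (2 * M * (r / word_deriv w x) * (C * word_deriv w x))).
  have rD0 : 0 <= r / word_deriv w x by rewrite divr_ge0 ?ltW.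
  have M20 : 0 <= 2 * M by rewrite mulr_ge0.
  by apply: ler_wpM2l => //; exact: mulr_ge0 M20 rD0.
rewrite [leLHS](_ : _ = 2 * M * C * r); last by field; rewrite gt_eqF.
rewrite /r mulrA ler_pdivrMr; last by rewrite !mulr_gt0//; lra.
rewrite mulrC ler_wpM2l ?(ltW ln20)//.
have : 0 <= M * C by rewrite mulr_ge0.
lra.
Qed.

(** [H] is the inverse of the map that blows up a ball around [x], with an integer
    translation that brings its domain around a point [z] of the unit interval;
    [p] is [r] divided by the derivative at [x]. *)
Lemma inverse_branches : exists (r : R) (N : set R), [/\ 0 < r, countable N &
  forall x (d : R), L x -> ~ N x -> 0 < d -> exists H (p z : R),
    [/\ D H, 0 < p < d, L z /\ 0 <= z < 1,
        (forall u, `|u - z| <= r / 2 -> `|H u - x| <= p) &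
        forall u v, `|u - z| <= r / 2 -> `|v - z| <= r / 2 ->
          p / (2 * r) * `|u - v| <= `|H u - H v| /\
          `|H u - H v| <= 2 * p / r * `|u - v| ]].
Proof.
have [r [N [r0 cN h]]] := conical_points.
exists r, N; split => // x d Lx Nx d0.
have [F [DF BF dF']] := h x (2 * r / d) Lx Nx.
have dF := dD DF.
have [H [DH FK HK]] := lift_group_inv gD DF.
set E : R := F^`()%classic x in BF dF'.
have E0 : 0 < E by exact: line_diffeo_gt0.
pose n := Num.floor (F x).
have := floor_itv (F x); rewrite -/n intrD1 => /andP[nF Fn].
have p0 : 0 < r / E by rewrite divr_gt0.
have FD (u v : R) : u < v -> `|u - x| <= r / E -> `|v - x| <= r / E ->
    E / 2 * (v - u) <= F v - F u <= 2 * E * (v - u).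
  move=> uv ux vx; have [c /andP[uc cv] ->] := line_diffeo_MVT dF uv.
  have : E / 2 <= F^`()%classic c <= 2 * E.
    by apply: dF'; move: ux vx; rewrite !ler_norml => /andP[? ?] /andP[? ?]; lra.
  by move=> /andP[c1 c2]; rewrite !ler_wpM2r// subr_ge0 ltW.
have Hnear u : `|u - F x| <= r / 2 -> `|H u - x| <= r / E.
  have e : E / 2 * (r / E) = r / 2 by field; rewrite gt_eqF.
  have /andP[+ _] : E / 2 * (x + r / E - x) <= F (x + r / E) - F x <= 2 * E * (x + r / E - x).
    apply: FD; first by rewrite ltrDl.
      by rewrite subrr normr0 ltW.
    by rewrite addrC addKr gtr0_norm.
  have /andP[+ _] : E / 2 * (x - (x - r / E)) <= F x - F (x - r / E) <= 2 * E * (x - (x - r / E)).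
    apply: FD; first by rewrite gtrBl.
      by rewrite addrC addKr normrN gtr0_norm.
    by rewrite subrr normr0 ltW.
  rewrite (_ : x - (x - r / E) = r / E); last by ring.
  rewrite (_ : (x + r / E) - x = r / E); last by ring.
  rewrite e => h1 h2; rewrite ler_norml => /andP[u1 u2].
  by rewrite ler_distl; apply/andP; split; rewrite -(line_diffeo_le dF) HK; lra.
exists (fun u => H (u + n%:~R)), (r / E), (F x - n%:~R); split.
- exact: (lift_group_comp gD DH (lift_group_shift gD n)).
- rewrite p0/= ltr_pdivrMr//; move: BF; rewrite ler_pdivrMr// [d * E]mulrC.
  by lra.
- split; last by apply/andP; split; lra.
  by rewrite -mulrNz; apply: (Linv (lift_group_shift gD (- n))); exact: Linv.
- move=> u; rewrite (_ : u - (F x - n%:~R) = (u + n%:~R) - F x); last by ring.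
  exact: Hnear.
move=> u v.
rewrite (_ : u - (F x - n%:~R) = (u + n%:~R) - F x); last by ring.
rewrite (_ : v - (F x - n%:~R) = (v + n%:~R) - F x); last by ring.
rewrite (_ : `|u - v| = `|(u + n%:~R) - (v + n%:~R)|); last by congr (`|_|); ring.
move: (u + _) (v + _) => {}u {}v ux vx.
have e1 : r / E / (2 * r) = (2 * E)^-1 by field; rewrite !gt_eqF.
have e2 : 2 * (r / E) / r = (E / 2)^-1 by field; rewrite !gt_eqF.
rewrite e1 e2.
have E20 : 0 < E / 2 by rewrite divr_gt0.
have E30 : 0 < 2 * E by rewrite mulr_gt0.
have main a b : `|a - F x| <= r / 2 -> `|b - F x| <= r / 2 -> a < b ->
    (2 * E)^-1 * `|a - b| <= `|H a - H b| /\ `|H a - H b| <= (E / 2)^-1 * `|a - b|.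
  move=> ax bx ab.
  have Hab : H a < H b by rewrite -(line_diffeo_lt dF) !HK.
  have := FD _ _ Hab (Hnear _ ax) (Hnear _ bx); rewrite !HK => /andP[h1 h2].
  rewrite !(distrC _ b) !(distrC _ (H b)) !gtr0_norm ?subr_gt0//.
  by split; [rewrite ler_pdivrMl|rewrite ler_pdivlMl].
case: (ltgtP u v) => uv; first exact: main.
  by rewrite (distrC u) (distrC (H u)); exact: main.
by rewrite uv !subrr normr0 !mulr0.
Qed.

Section Cells.
Variable (m : nat).
Hypothesis m0 : (0 < m)%N.
(** Three consecutive intervals of a subdivision, so that every point of the middle
    one has a neighbourhood of fixed size inside the cell. *)
Definition cell (i : nat) : set R := [set u | i%:R - 1 <= u * m%:R <= i%:R + 2].

(** Only the middle interval of the cell is asked to meet [L]. *)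
Definition occupied i := exists2 z, L z & i%:R <= z * m%:R < i%:R + 1.

Let m0' : 0 < m%:R :> R. Proof. by rewrite ltr0n. Qed.

Lemma cell_itv i u : cell i u <-> (i%:R - 1) / m%:R <= u <= (i%:R + 2) / m%:R.
Proof. by rewrite /cell /= ler_pdivrMr// ler_pdivlMr. Qed.

Lemma cell_diam i u v : cell i u -> cell i v -> `|u - v| <= 3 / m%:R.
Proof.
rewrite /cell /= ler_pdivlMr// => /andP[? ?] /andP[? ?].
rewrite -[X in _ * X](gtr0_norm m0') -normrM mulrBl ler_norml; apply/andP; split; lra.
Qed.

Lemma cell_nbhd i z u : i%:R <= z * m%:R < i%:R + 1 -> `|u - z| <= m%:R^-1 ->
  cell i u.
Proof.
move=> /andP[z1 z2].
rewrite -(ler_pM2r m0') mulVf ?gt_eqF// -[X in _ * X](gtr0_norm m0') -normrM.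
rewrite mulrBl ler_norml /cell /= => /andP[? ?]; apply/andP; split; lra.
Qed.

Lemma cell_of (z : R) : 0 <= z < 1 -> exists i : 'I_m, i%:R <= z * m%:R < i%:R + 1.
Proof.
move=> /andP[z0 z1].
have zm0 : 0 <= z * m%:R by rewrite mulr_ge0// ltW.
have := truncn_itv zm0; rewrite -natr1 => /andP[h1 h2].
have im : (Num.trunc (z * m%:R) < m)%N.
  by rewrite -(ltr_nat R) (le_lt_trans h1)// gtr_pMl.
by exists (Ordinal im); rewrite /= h1.
Qed.

End Cells.

(** With finitely many possible domains for the inverse branches, a pigeonhole
    argument can select branches with a common domain. *)
Lemma branches_to_cells : exists (r : R) (N : set R) (m : nat), [/\ 0 < r, countable N,
    (0 < m)%N, 3 / m%:R < 2^-1 :> R &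
  forall x (d : R), L x -> ~ N x -> 0 < d -> exists H (p : R) (i : 'I_m),
    [/\ D H, 0 < p < d, occupied m i,
        (forall u, cell m i u -> `|H u - x| <= p) &
        forall u v, cell m i u -> cell m i v ->
          p / (2 * r) * `|u - v| <= `|H u - H v| /\
          `|H u - H v| <= 2 * p / r * `|u - v| ]].
Proof.
have [r [N [r0 cN h]]] := inverse_branches.
have [m m0 mr] : exists2 m, (0 < m)%N & 3 / m%:R < Num.min (r / 2) 2^-1.
  have e0 : 0 < Num.min (r / 2) 2^-1 by rewrite lt_min divr_gt0//= invr_gt0.
  pose m := (Num.trunc (3 / Num.min (r / 2) 2^-1)).+1.
  exists m => //; rewrite ltr_pdivrMr ?ltr0n// mulrC -ltr_pdivrMr//.
  exact: truncnS_gt.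
move: mr; rewrite lt_min => /andP[mr m2].
exists r, N, m; split => // x d Lx Nx d0.
have [H [p [z [DH pd [Lz z01] h1 h2]]]] := h x d Lx Nx d0.
have [i zi] := cell_of m0 z01.
have zc : cell m i z by apply: (cell_nbhd m0 zi); rewrite subrr normr0 invr_ge0.
have cz u : cell m i u -> `|u - z| <= r / 2.
  by move=> cu; rewrite (le_trans (cell_diam m0 cu zc))// ltW.
exists H, p, i; split => //; first by exists z.
  by move=> u /cz; exact: h1.
by move=> u v /cz uz /cz vz; exact: h2.
Qed.

End Group.
End Selection.

(** * Contracting systems in a group of lifts *)

Section Systems.
Context {R : realType}.
Implicit Types (F G H : R -> R) (x y t : R).

(** An iterated function system on [[a, b]] made of elements of [D], with disjoint
    images.  The condition [system_sum] on the lower contraction ratios forces the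
    dimension of suitable self-similar measures to be at least [s].  The length of
    the interval is less than [2^-1] so that it embeds isometrically in the
    circle. *)
Record contracting_system (D : set (R -> R)) (L : set R) (s a b : R) (n : nat)
    (F : 'I_n -> R -> R) (c : 'I_n -> R) : Prop := ContractingSystem {
  system_itv : a < b < a + 2^-1;
  system_meets : exists2 z, L z & a <= z <= b;
  system_group : forall i, D (F i);
  system_maps : forall i u, a <= u <= b -> a <= F i u <= b;
  system_disjoint : forall i j u v, a <= u <= b -> a <= v <= b ->
    F i u = F j v -> i = j;
  system_lower : forall i u v, a <= u <= b -> a <= v <= b ->
    c i * `|u - v| <= `|F i u - F i v|;
  system_upper : forall i u v, a <= u <= b -> a <= v <= b ->
    `|F i u - F i v| <= 2^-1 * `|u - v|;
  system_ratio : forall i, 0 < c i;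
  system_sum : 1 <= \sum_i (c i) `^ s }.

(** Fine covers of a fundamental domain of [L] have arbitrarily large [s]-sums,
    that is, the [s]-dimensional Hausdorff measure is infinite; stated with finite
    partial sums only.  The diameters are replaced by upper bounds [w k], among
    which zeros are allowed. *)
Definition large_covers (L : set R) (s : R) := forall T : R, exists2 d : R, 0 < d &
  forall (U : nat -> set R) (w : nat -> R),
    (forall k, 0 <= w k <= d /\ forall u v, U k u -> U k v -> `|u - v| <= w k) ->
    (forall x, L x -> 0 <= x < 1 -> exists k, U k x) ->
    exists n, T <= \sum_(k < n) (w k) `^ s.

(** Vitali covering: from the balls of radius [p x] one selects disjoint ones
    whose five-fold enlargements cover the same set.  Together with the points of
    [N], as sets of width 0, the enlarged balls form a cover with widths
    [10 * p x], whence the factor [10 `^ s]. *)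
Lemma disjoint_balls_large_sum (L N : set R) (s T : R) : 0 < s ->
  large_covers L s -> countable N ->
  exists2 d, 0 < d & forall p : R -> R,
    (forall x, L x -> ~ N x -> 0 < p x < d) ->
    exists t : seq R, [/\ uniq t, (forall x, x \in t -> [/\ L x, ~ N x & 0 <= x < 1]),
      (forall x y u, x \in t -> y \in t -> `|u - x| <= p x -> `|u - y| <= p y -> x = y) &
      T <= \sum_(x <- t) (p x) `^ s].
Proof.
move=> s0 hL cN.
have [d d0 hd] := hL (10 `^ s * T).
exists (d / 10); first by rewrite divr_gt0.
move=> p0 hp0.
pose V : set R := [set x | (L x /\ 0 <= x < 1) /\ ~ N x].
pose p x := if pselect (V x) then p0 x else 1.
have pV x : V x -> p x = p0 x by rewrite /p; case: pselect.
have ppos x : 0 < p x.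
  have [Vx|nVx] := pselect (V x); last by rewrite /p; case: pselect.
  rewrite pV//; have [[Lx _] Nx] := Vx.
  by have /andP[] := hp0 x Lx Nx.
pose B x : set R := ball x (p x).
have [||| E [cE EV tE covE]] := @vitali_lemma_infinite_cover R R B V (d / 10).
- by move=> x; exact: is_ball_ball.
- by move=> x; rewrite /B radius_ball_num ?ltW.
- move=> x Vx; rewrite /B radius_ball_num ?(ltW (ppos _))// pV//.
  by case: Vx => -[Lx _] Nx; have /andP[_ /ltW] := hp0 x Lx Nx.
have clB (x r u : R) : 0 < r -> closure (ball x r) u <-> `|u - x| <= r.
  move=> r0; rewrite -/(closed_ball x r) closed_ballE//.
  by rewrite /closed_ball_ /= distrC.
have [f fE] := countable_injP _ cE; have [g gN] := countable_injP _ cN.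
(* even ranks carry the enlarged balls, odd ranks the points of [N] *)
have [e he] : exists e : nat -> option R, forall k x,
    e k = Some x <-> E x /\ k = (f x).*2.
  have /choice[e he] : forall k, exists o : option R, forall x,
      o = Some x <-> E x /\ k = (f x).*2.
    move=> k; have [[x [Ex kx]]|nx] := pselect (exists x, E x /\ k = (f x).*2).
      exists (Some x) => y; split => [[<-]//|[Ey ky]]; congr Some.
      by apply: fE; rewrite ?inE//; apply: double_inj; rewrite -kx.
    by exists None => x; split => // -[Ex kx]; exfalso; apply: nx; exists x.
  by exists e.
pose w k : R := oapp (fun x => 10 * p x) 0 (e k).
pose U k : set R := [set u | (exists2 x, e k = Some x & `|u - x| <= 5 * p x) \/
  (N u /\ k = (g u).*2.+1)].
have [||n] := hd U w.
- move=> k; split.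
    rewrite /w; case ek : (e k) => [x|]/=; last by rewrite lexx ltW.
    have [Ex _] := (he k x).1 ek; have px := ppos x.
    rewrite mulr_ge0// ?(ltW px)//= mulrC -ler_pdivlMr// pV; last exact: EV.
    by have [[Lx _] Nx] := EV x Ex; have /andP[_ /ltW] := hp0 x Lx Nx.
  move=> u v [[x ex ux]|[Nu ku]] [[y ey vy]|[Nv kv]].
  + rewrite /w ex; move: ey; rewrite ex => -[yx] /=; rewrite -yx in vy.
    by move: ux vy; rewrite !ler_norml => /andP[? ?] /andP[? ?]; apply/andP; split; lra.
  + have [_ k1] := (he k x).1 ex; have := congr1 odd k1.
    by rewrite kv /= !odd_double.
  + have [_ k1] := (he k y).1 ey; have := congr1 odd k1.
    by rewrite ku /= !odd_double.
  + have -> : u = v.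
      by apply: gN; rewrite ?inE//; apply: double_inj; move: ku; rewrite kv => -[].
    rewrite subrr normr0 /w; case: (e k) => //= x.
    by rewrite mulr_ge0// ltW.
- move=> x Lx x01; have [Nx|Nx] := pselect (N x).
    by exists (g x).*2.+1; right.
  have Vx : V x by [].
  have [|y Ey xy] := covE x.
    by exists x => //; apply/clB => //; rewrite subrr normr0 ltW.
  exists (f y).*2; left; exists y; first exact/he.
  move: xy; rewrite /= /B scale_ballE// => /clB; apply.
  by rewrite mulr_gt0.
move=> hn.
exists (pmap e (iota 0 n)).
have tE' x : x \in pmap e (iota 0 n) -> E x.
  by rewrite mem_pmap => /mapP[k _ /esym/he[]].
split.
- apply: (@pmap_uniq _ _ e (fun x => (f x).*2)); last exact: iota_uniq.
  by move=> k /=; case ek : (e k) => [x|]//=; have [_ ->] := (he k x).1 ek.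
- by move=> x /tE'/EV[[Lx x01] Nx].
- move=> x y u xt yt ux uy; have Ex := tE' x xt; have Ey := tE' y yt.
  apply: tE => //; exists u; split; apply/clB => //=; rewrite pV//; exact: EV.
have -> : \sum_(x <- pmap e (iota 0 n)) p0 x `^ s =
    \sum_(x <- pmap e (iota 0 n)) p x `^ s.
  rewrite big_seq [RHS]big_seq; apply: eq_bigr => x /tE'/EV Vx.
  by rewrite pV.
rewrite -(ler_pM2l (_ : 0 < 10 `^ s)) ?powR_gt0//.
apply: (le_trans hn); rewrite -(big_mkord xpredT (fun k => w k `^ s)) /index_iota subn0.
elim: (iota 0 n) => [|k r IH]; first by rewrite !big_nil mulr0.
rewrite big_cons /= /w; case ek : (e k) => [x|] /=; last first.
  by rewrite powR0 ?gt_eqF// add0r.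
rewrite big_cons mulrDr; apply: lerD => //.
by rewrite powRM// ltW.
Qed.

Lemma pigeonhole_sum (m : nat) (t : seq R) (v : R -> R) (k : R -> 'I_m) (T : R) :
  (0 < m)%N -> m%:R * T <= \sum_(x <- t) v x ->
  exists i, T <= \sum_(x <- t | k x == i) v x.
Proof.
move=> m0 hT; apply: contrapT => /forallNP nT.
have : \sum_(x <- t) v x < m%:R * T.
  rewrite (partition_big k xpredT)//=.
  have -> : m%:R * T = \sum_(i < m) T by rewrite sumr_const card_ord mulr_natl.
  apply: ltr_sum => [|i _]; first by apply/hasP; exists (Ordinal m0) => //; rewrite mem_index_enum.
  by rewrite ltNge; apply/negP/nT.
by rewrite ltNge hT.
Qed.

Section Group.
Variables (D : set (R -> R)) (L : set R).
Hypothesis gD : lift_group D.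
Let dD := lift_group_diffeo gD.
Hypothesis Linv : forall F x, D F -> L x -> L (F x).
Hypothesis Lclosed : closed L.
Hypothesis Lexp : forall x, L x -> locally_expandable D x.
Hypothesis Lmin : forall x y (e : R), L x -> L y -> 0 < e ->
  exists2 F, D F & `|F x - y| < e.

Lemma move_near (J : set R) z (e : R) y : L y -> L z -> 0 < e ->
  (forall u, `|u - z| < e -> J u) ->
  exists h (k : R), [/\ D h, 0 < k & forall u, `|u - y| < k -> J (h u)].
Proof.
move=> Ly Lz e0 hJ; have [h Dh hy] := Lmin Ly Lz e0.
have [k k0 hk] := line_diffeo_bilipschitz (dD Dh).
exists h, (k * (e - `|h y - z|)); split => //.
  by rewrite mulr_gt0// subr_gt0.
move=> u uy; apply: hJ.
have /= [_ h2] := hk u y.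
have : k^-1 * `|u - y| < e - `|h y - z| by rewrite ltr_pdivrMl.
have := ler_distD (h y) (h u) z.
by move: h2; lra.
Qed.

(** By minimality every point of [L] can be moved into [J], together with a
    neighbourhood; compactness makes the choice finite. *)
Lemma finitely_many_maps_into (J : set R) z (e : R) : L z -> 0 < e ->
  (forall u, `|u - z| < e -> J u) ->
  exists (S : seq (R -> R)) (l : R), [/\ (forall F, F \in S -> D F), 0 < l &
    forall x, L x -> 0 <= x < 1 ->
      exists2 a, a \in S & forall u, `|u - x| <= l -> J (a u)].
Proof.
move=> Lz e0 hJ.
pose K : set R := `[0, 1]%classic `&` L.
pose P (A : set R) := exists (S : seq (R -> R)) (l : R),
  [/\ (forall F, F \in S -> D F), 0 < l &
    forall x, A x -> exists2 a, a \in S & forall u, `|u - x| <= l -> J (a u)].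
have [S [l [SD l0 h]]] : P K.
  apply: compact_local_to_global.
  - apply: (@subclosed_compact R K `[0, 1]%classic); last by move=> ? [].
      apply: closedI => //; exact: itv_closed.
    exact: segment_compact.
  - by exists [::], 1; split.
  - move=> A B [S1 [l1 [SD1 l10 h1]]] [S2 [l2 [SD2 l20 h2]]].
    exists (S1 ++ S2), (Num.min l1 l2); split.
    + by move=> F; rewrite mem_cat => /orP[/SD1|/SD2].
    + by rewrite lt_min l10.
    + move=> x [/h1|/h2] [a aS ha]; exists a; rewrite ?mem_cat ?aS ?orbT// => u;
        by rewrite le_min => /andP[? ?]; apply: ha.
  - move=> A B AB [S [l [? ? h]]]; exists S, l; split => // x /AB.
    exact: h.
  move=> y [_ Ly]; have [a [k [Da k0 ha]]] := move_near Ly Lz e0 hJ.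
  exists (k / 2); first by rewrite divr_gt0.
  exists [:: a], (k / 3); split => [F||x].
  - by rewrite inE => /eqP ->.
  - by rewrite divr_gt0.
  rewrite /ball /= => yx; exists a; first by rewrite inE.
  move=> u ux; apply: ha; have := ler_distD x u y.
  by rewrite (distrC x y); lra.
exists S, l; split => // x Lx /andP[x0 x1]; apply: h; split => //.
by rewrite /= in_itv/= x0 ltW.
Qed.

(** The maps are [a \o H_x \o h_x], where [H_x] contracts a cell [i_x] into the ball
    of radius [p x] around [x], [h_x] sends a fixed cell [J] into the cell [i_x] and
    [a] sends the ball back into [J].  The cell [J] is chosen such that [h_x]
    exists, and [a] ranges over a finite set by compactness.  The points [x] are
    selected by Vitali so that their balls are disjoint and the sum of the
    [p x `^ s] is large; by the pigeonhole principle a single [a] can serve a subset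
    of them with a still large sum, and its injectivity keeps the images
    disjoint. *)
Lemma exists_contracting_system (s : R) : 0 < s -> large_covers L s ->
  L !=set0 -> exists a b n (F : 'I_n -> R -> R) c, contracting_system D L s a b F c.
Proof.
move=> s0 hL [z0 Lz0].
have [r [N [m [r0 cN m0 m3 hbr]]]] := branches_to_cells gD Linv Lclosed Lexp.
have m0' : 0 < m%:R :> R by rewrite ltr0n.
(* countable sets have fine covers with small sums, so [L] is not inside [N] *)
have [y0 Ly0 Ny0] : exists2 y, L y & ~ N y.
  have [d d0 hd] := disjoint_balls_large_sum 1 s0 hL cN.
  have [|t [_ tL _ t1]] := hd (fun=> d / 2).
    by move=> x _ _; rewrite divr_gt0//= ltr_pdivrMr// ltr_pMr// ltr1n.
  case: t tL t1 => [_|x t /(_ x (mem_head _ _))[]]; last by exists x.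
  by rewrite big_nil ler10.
(* [istar] is a cell which reaches [y0] by arbitrarily strong contractions *)
have [istar [oistar hstar]] : exists i : 'I_m, occupied L m i /\
    forall d : R, 0 < d -> exists2 H, D H & forall u, cell m i u -> `|H u - y0| <= d.
  apply: contrapT => /forallNP no.
  have /choice[d hd] : forall i : 'I_m, exists d : R, 0 < d /\
     (occupied L m i -> forall H, D H -> ~ (forall u, cell m i u -> `|H u - y0| <= d)).
    move=> i; apply: contrapT => /forallNP no'; apply: (no i); split.
      have := no' 1; apply: contra_notP => oi; split => //.
    move=> d d0; apply: contrapT => noH; apply: (no' d); split => // oi H DH hH.
    by apply: noH; exists H.
  have [e e0 he] := finite_pos_lower_bound (fun i => (hd i).1).
  have [H [p [i [DH /andP[p0 pe] oi Hp _]]]] := hbr y0 e Ly0 Ny0 e0.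
  apply: ((hd i).2 oi H DH) => u /Hp /le_trans; apply.
  by rewrite (le_trans (ltW pe)).
set J := cell m istar in hstar.
(* contract [J] to a small neighbourhood of [y0], then move [y0] into the cell *)
have [kh kh0 hh] : exists2 k : R, 0 < k & forall j : 'I_m, occupied L m j ->
    exists h, [/\ D h, (forall u, J u -> cell m j (h u)) &
      forall u v, k * `|u - v| <= `|h u - h v| /\ `|h u - h v| <= k^-1 * `|u - v|].
  have /choice[k hk] : forall j : 'I_m, exists k : R, 0 < k /\ (occupied L m j ->
    exists h, [/\ D h, (forall u, J u -> cell m j (h u)) &
      forall u v, k * `|u - v| <= `|h u - h v| /\ `|h u - h v| <= k^-1 * `|u - v|]).
    move=> j; have [[zj Lzj zj1]|nj] := pselect (occupied L m j); last by exists 1.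
    have [||h1 [d [Dh1 d0 hd]]] := @move_near (cell m j) zj (m%:R^-1) y0 Ly0 Lzj.
    - by rewrite invr_gt0.
    - by move=> u uz; apply: (cell_nbhd m0 zj1); rewrite ltW.
    have d20 : 0 < d / 2 by rewrite divr_gt0.
    have [H DH hH] := hstar _ d20.
    have DhH : D (h1 \o H) by apply: (lift_group_comp gD).
    have [k k0 hk] := line_diffeo_bilipschitz (dD DhH).
    exists k; split => // _; exists (h1 \o H); split => // u Ju.
    by apply: hd; rewrite (le_lt_trans (hH u Ju))// ltr_pdivrMr// ltr_pMr// ltr1n.
  have [e e0 he] := finite_pos_lower_bound (fun i => (hk i).1).
  exists e => // j oj; have [kj0 /(_ oj)[h [Dh hJ hl]]] := hk j.
  exists h; split => // u v; have [l1 l2] := hl u v; split.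
    by apply: le_trans l1; rewrite ler_wpM2r.
  by apply: (le_trans l2); rewrite ler_wpM2r// lef_pV2 ?posrE.
have [zs Lzs zs1] := oistar.
have [||S [l [SD l0 hS]]] := @finitely_many_maps_into J zs (m%:R^-1) Lzs.
- by rewrite invr_gt0.
- by move=> u uz; apply: (cell_nbhd m0 zs1); rewrite ltW.
have [ka ka0 hka] : exists2 k : R, 0 < k & forall a, a \in S -> forall u v,
    k * `|u - v| <= `|a u - a v| /\ `|a u - a v| <= k^-1 * `|u - v|.
  have : forall F, F \in S -> line_diffeo F by move=> F /SD/dD.
  elim: (S) => [_|F S' IH dS]; first by exists 1.
  have [|k k0 hk] := IH; first by move=> G GS; apply: dS; rewrite in_cons GS orbT.
  have [k' k'0 hk'] := line_diffeo_bilipschitz (dS F (mem_head _ _)).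
  have q0 : 0 < Num.min k k' by rewrite lt_min k0.
  exists (Num.min k k') => // a; rewrite in_cons => aS u v.
  have [k1 [k10 mk [l1 l2]]] : exists k1 : R, [/\ 0 < k1, Num.min k k' <= k1 &
      k1 * `|u - v| <= `|a u - a v| /\ `|a u - a v| <= k1^-1 * `|u - v|].
    case/orP: aS => [/eqP ->|/hk aS].
      by exists k'; split => //; rewrite ge_min lexx orbT.
    by exists k; split => //; rewrite ge_min lexx.
  split; first by apply: le_trans l1; rewrite ler_wpM2r.
  by apply: (le_trans l2); rewrite ler_wpM2r// lef_pV2 ?posrE.
have Snil : (0 < size S)%N.
  have fl : 0 <= z0 + (- Num.floor z0)%:~R < 1.
    have := floor_itv z0; rewrite intrD1 mulrNz => /andP[? ?].
    by apply/andP; split; lra.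
  have [|a aS _] := hS _ _ fl; first exact: (Linv (lift_group_shift gD _)).
  by case: (S) aS.
(* [c0 * p x] is the lower ratio of [a \o H_x \o h_x]: one factor for each map *)
pose c0 := ka * (2 * r)^-1 * kh.
have c00 : 0 < c0 by rewrite /c0 !mulr_gt0// invr_gt0 mulr_gt0.
have [d d0 hd] := disjoint_balls_large_sum ((size S)%:R * (c0 `^ s)^-1) s0 hL cN.
(* the bound [ka * (r / 4) * kh] makes the upper ratio at most [2^-1] *)
pose d1 := Num.min d (Num.min l (ka * (r / 4) * kh)).
have d10 : 0 < d1 by rewrite !lt_min d0 l0 !mulr_gt0// divr_gt0.
have /choice[Hp hHp] : forall x, exists Hp : (R -> R) * R * 'I_m, L x -> ~ N x ->
    [/\ D Hp.1.1, 0 < Hp.1.2 < d1, occupied L m Hp.2,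
      (forall u, cell m Hp.2 u -> `|Hp.1.1 u - x| <= Hp.1.2) &
      forall u v, cell m Hp.2 u -> cell m Hp.2 v ->
          Hp.1.2 / (2 * r) * `|u - v| <= `|Hp.1.1 u - Hp.1.1 v| /\
          `|Hp.1.1 u - Hp.1.1 v| <= 2 * Hp.1.2 / r * `|u - v| ].
  move=> x; have [[Lx Nx]|nx] := pselect (L x /\ ~ N x).
    by have [H [p [i h]]] := hbr x d1 Lx Nx d10; exists (H, p, i).
  by exists (id, 0, istar) => Lx Nx; exfalso; apply: nx.
pose p x := (Hp x).1.2.
have [|t [ut tL tdisj tT]] := hd p.
  move=> x Lx Nx; have [_ /andP[p0 pd] _ _ _] := hHp x Lx Nx.
  by rewrite p0 (lt_le_trans pd)// ge_min lexx.
have /choice[h hhx] : forall x, exists h, L x -> ~ N x ->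
    [/\ D h, (forall u, J u -> cell m (Hp x).2 (h u)) &
      forall u v, kh * `|u - v| <= `|h u - h v| /\ `|h u - h v| <= kh^-1 * `|u - v|].
  move=> x; have [[Lx Nx]|nx] := pselect (L x /\ ~ N x).
    have [_ _ o _ _] := hHp x Lx Nx; have [h hx] := hh _ o.
    by exists h.
  by exists id => Lx Nx; exfalso; apply: nx.
have /choice[al hal] : forall x, exists i : 'I_(size S), L x -> 0 <= x < 1 ->
    forall u, `|u - x| <= l -> J (nth id S i u).
  move=> x; have [[Lx x01]|nx] := pselect (L x /\ 0 <= x < 1).
    have [a aS ha] := hS x Lx x01.
    have iS : (index a S < size S)%N by rewrite index_mem.
    by exists (Ordinal iS) => _ _ u /=; rewrite nth_index//; exact: ha.
  by exists (Ordinal Snil) => Lx x01; exfalso; apply: nx.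
have [i ti] := pigeonhole_sum al Snil tT.
set a := nth id S i in hal.
have aS : a \in S by rewrite mem_nth.
pose t' := [seq x <- t | al x == i].
have t'P x : x \in t' -> [/\ x \in t, L x, ~ N x, 0 <= x < 1 & al x = i].
  by rewrite mem_filter => /andP[/eqP aix xt]; have [] := tL x xt.
pose f x := a \o (Hp x).1.1 \o h x.
pose X (j : 'I_(size t')) := nth 0 t' j.
have Xt' j : X j \in t' by rewrite mem_nth.
have Jitv u : (istar%:R - 1) / m%:R <= u <= (istar%:R + 2) / m%:R -> J u.
  by move=> h1; apply/(cell_itv m0).
have px x : x \in t' -> 0 < p x < d1 by move=> /t'P[_ Lx Nx _ _]; have [] := hHp x Lx Nx.
have hball x u : x \in t' -> J u -> `|(Hp x).1.1 (h x u) - x| <= p x.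
  move=> /t'P[_ Lx Nx _ _] Ju; have [_ _ _ h1 _] := hHp x Lx Nx.
  by apply: h1; have [_ + _] := hhx x Lx Nx; apply.
have fJ x u : x \in t' -> J u -> J (f x u).
  move=> xt' Ju; have [_ Lx _ x01 ax] := t'P x xt'.
  have := hal x Lx x01; rewrite ax -/a; apply.
  rewrite (le_trans (hball x u xt' Ju))//; have /andP[_ /ltW/le_trans] := px x xt'.
  by apply; rewrite ge_min ge_min lexx orbT.
have flip x u v : x \in t' -> J u -> J v ->
    c0 * p x * `|u - v| <= `|f x u - f x v| /\ `|f x u - f x v| <= 2^-1 * `|u - v|.
  move=> xt' Ju Jv; have [_ Lx Nx _ _] := t'P x xt'.
  have [_ _ _ _ h2] := hHp x Lx Nx; have [_ hc h3] := hhx x Lx Nx.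
  have [l1 u1] := h3 u v; have [l2 u2] := h2 _ _ (hc u Ju) (hc v Jv).
  have [l3 u3] := hka a aS ((Hp x).1.1 (h x u)) ((Hp x).1.1 (h x v)).
  have /andP[p0 pd] := px x xt'.
  split.
    apply: le_trans l3; rewrite (_ : c0 * p x * _ = ka * (p x / (2 * r) * (kh * `|u - v|))).
      apply: ler_wpM2l; first exact: ltW.
      apply: le_trans l2; apply: ler_wpM2l => //.
      by rewrite divr_ge0 ?mulr_ge0 ?ltW.
    by rewrite /c0; ring.
  apply: (le_trans u3).
  apply: (@le_trans _ _ (ka^-1 * (2 * p x / r * (kh^-1 * `|u - v|)))).
    apply: ler_wpM2l; first by rewrite invr_ge0 ltW.
    apply: (le_trans u2); apply: ler_wpM2l => //.
    by rewrite divr_ge0 ?mulr_ge0 ?ltW.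
  rewrite !mulrA ler_wpM2r//.
  have -> : ka^-1 * 2 * p x / r / kh = 2 * p x / (ka * r * kh).
    by field; rewrite !gt_eqF.
  rewrite ler_pdivrMr ?mulr_gt0//.
  have : p x <= ka * (r / 4) * kh.
    by rewrite (le_trans (ltW pd))// ge_min ge_min lexx !orbT.
  by lra.
exists ((istar%:R - 1) / m%:R), ((istar%:R + 2) / m%:R), (size t').
exists (fun j => f (X j)), (fun j => c0 * p (X j)); split.
- have -> : (istar%:R + 2) / m%:R = (istar%:R - 1) / m%:R + 3 / m%:R :> R.
    by rewrite -mulrDl; congr (_ / _); ring.
  by rewrite ltrDl divr_gt0//= ltrD2l.
- exists zs => //; apply/(cell_itv m0); apply: (cell_nbhd m0 zs1).
  by rewrite subrr normr0 invr_ge0 ltW.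
- move=> j; have [_ Lx Nx _ _] := t'P _ (Xt' j).
  have [DH _ _ _ _] := hHp _ Lx Nx; have [Dh _ _] := hhx _ Lx Nx.
  by do 2 apply: (lift_group_comp gD) => //; exact: SD.
- by move=> j u /Jitv Ju; apply/(cell_itv m0)/fJ.
- move=> j j' u v /Jitv Ju /Jitv Jv /(line_diffeo_inj (dD (SD a aS))) e.
  have [t1 _ _ _ _] := t'P _ (Xt' j); have [t2 _ _ _ _] := t'P _ (Xt' j').
  have := tdisj _ _ _ t1 t2 (hball _ _ (Xt' j) Ju).
  rewrite e => /(_ (hball _ _ (Xt' j') Jv)) /eqP.
  by rewrite nth_uniq ?filter_uniq// => /eqP/val_inj.
- by move=> j u v /Jitv Ju /Jitv Jv; have [] := flip _ _ _ (Xt' j) Ju Jv.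
- by move=> j u v /Jitv Ju /Jitv Jv; have [] := flip _ _ _ (Xt' j) Ju Jv.
- by move=> j; rewrite mulr_gt0//; have /andP[] := px _ (Xt' j).
rewrite (_ : \sum_j _ = c0 `^ s * \sum_(x <- t | al x == i) p x `^ s).
  by rewrite mulrC -ler_pdivrMr ?powR_gt0// mul1r.
have -> : \sum_(x <- t | al x == i) p x `^ s = \sum_(j < size t') p (X j) `^ s.
  by rewrite -big_filter -/t' (big_nth 0) big_mkord.
rewrite mulr_sumr; apply: eq_bigr => j _.
by rewrite powRM ?ltW//; have /andP[] := px _ (Xt' j).
Qed.

End Group.
End Systems.

(** * Lifting circle diffeomorphisms to the line *)

Section CircleLifts.
Context {R : realType}.
Implicit Types (F G H : R -> R) (s t : R) (x y : circle R) (g : circle R -> circle R).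

Lemma circle_pi_repr x : circle_pi (repr x) = x.
Proof. exact: reprK. Qed.

Lemma circle_pi_addz t (n : int) : circle_pi (t + n%:~R) = circle_pi t.
Proof. by apply/circle_piP; rewrite addrC addKr intr_int. Qed.

Lemma circle_pi_eq s t : circle_pi s = circle_pi t -> exists n : int, s = t + n%:~R.
Proof.
by move/circle_piP/intrP => [n e]; exists n; rewrite -e addrC subrK.
Qed.

Lemma circle_pi_continuous : continuous (@circle_pi R).
Proof. exact: pi_continuous. Qed.

Lemma circle_openP (A : set (circle R)) : open A <-> open (@circle_pi R @^-1` A).
Proof. by []. Qed.

Lemma circle_closedP (A : set (circle R)) : closed A <-> closed (@circle_pi R @^-1` A).
Proof. by rewrite -!openC circle_openP preimage_setC. Qed.

Lemma circle_pi_open (A : set R) : open A -> open (@circle_pi R @` A).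
Proof.
move=> oA; apply/circle_openP.
rewrite (_ : _ @^-1` _ = \bigcup_(n : int) ((fun t => t + n%:~R) @^-1` A)).
  apply: bigcup_open => n _; apply: open_comp => // t _.
  by apply: cvgD; [exact: cvg_id|exact: cvg_cst].
apply/seteqP; split => [t [u Au /circle_pi_eq[n e]]|t [n _ /= At]].
  by exists n => //=; rewrite -e.
by exists (t + n%:~R) => //; exact: circle_pi_addz.
Qed.

Lemma integer_valued_continuous (h : R -> R) : continuous h ->
  (forall t, h t \is a Num.int) -> forall s t, h s = h t.
Proof.
move=> ch ih; suff main s t : s < t -> h s = h t.
  by move=> s t; case: (ltgtP s t) => [/main|/main|->].
move=> st; apply: contrapT => hst.
have /intrP[m hm] := ih s; have /intrP[n hn] := ih t.
have mn : m != n by apply/eqP => e; apply: hst; rewrite hm hn e.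
have [k hk1 hk2] : exists2 k : int, Num.min (h s) (h t) = k%:~R &
    k%:~R + 1 <= Num.max (h s) (h t).
  rewrite hm hn; case: (ltgtP m n) mn => // mn _.
    exists m; first by rewrite min_l// ler_int ltW.
    by rewrite max_r ?ler_int ?(ltW mn)// -intrD1 ler_int lezD1.
  exists n; first by rewrite min_r// ler_int ltW.
  by rewrite max_l ?ler_int ?(ltW mn)// -intrD1 ler_int lezD1.
have [||c _ hc] := @IVT _ h s t (k%:~R + 2^-1) (ltW st).
- exact: continuous_subspaceT.
- by rewrite hk1; apply/andP; split; lra.
have /intrP[l] := ih c; rewrite hc => e.
have : (k%:~R < l%:~R :> R) && (l%:~R < (k + 1)%:~R :> R).
  by rewrite -e intrD1; apply/andP; split; lra.
by rewrite !ltr_int ltzD1 => /andP[/lt_le_trans h1 /h1]; rewrite ltxx.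
Qed.

Lemma lift_unique F G : continuous F -> continuous G ->
  (forall t, circle_pi (F t) = circle_pi (G t)) ->
  exists n : int, forall t, F t = G t + n%:~R.
Proof.
move=> cF cG e.
have h : forall s t, F s - G s = F t - G t.
  apply: (@integer_valued_continuous (fun t => F t - G t)) => t.
    by apply: cvgB; [exact: cF|exact: cG].
  exact/circle_piP.
have /circle_pi_eq[n en] := e 0; exists n => t.
by have := h t 0; rewrite en; lra.
Qed.

Lemma lift_shift g F (n : int) : is_lift g F -> is_lift g (fun t => F t + n%:~R).
Proof.
move=> [cF eF]; split; last by move=> t; rewrite circle_pi_addz.
by move=> t; apply: cvgD; [exact: cF|exact: cvg_cst].
Qed.

Lemma line_diffeo_addc F (c : R) : line_diffeo F -> line_diffeo (fun t => F t + c) /\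
  (forall t, (fun t => F t + c)^`()%classic t = F^`()%classic t).
Proof.
move=> dF.
have dd t : is_derive t 1 (fun t => F t + c) (F^`()%classic t).
  have h := line_diffeo_is_derive t dF.
  have h2 : is_derive t 1 (cst c : R -> R) 0 by exact: is_derive_cst.
  by have := is_deriveD h h2; rewrite addr0.
have e t : (fun t => F t + c)^`()%classic t = F^`()%classic t.
  by rewrite derive1E derive_val.
split => //; split.
- by move=> t; have [] := dd t.
- by move=> t; rewrite e line_diffeo_gt0.
- have [M M0 hM] := line_diffeo_distortion dF; exists M => // s t.
  by rewrite !e.
- by move=> t; rewrite line_diffeo_shift1// addrAC.
Qed.

(** The logarithmic derivative [F'' / F'] is continuous, hence bounded on a
    compact interval; periodicity reduces all pairs of points to that interval. *)
Lemma C2_log_lipschitz F : C2_real F -> (forall t, 0 < F^`()%classic t) ->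
  (forall t (n : int), F^`()%classic (t + n%:~R) = F^`()%classic t) ->
  exists2 M, 0 <= M & forall s t,
    `|ln (F^`()%classic s) - ln (F^`()%classic t)| <= M * `|s - t|.
Proof.
move=> [dF cF2] F0 Fp; set f := F^`()%classic in F0 Fp *.
have df t : derivable f t 1 by have := dF 1%N t isT; rewrite derive1n1.
have cf : continuous f.
  by move=> t; apply/differentiable_continuous/derivable1_diffP.
have f2 : F^`(2)%classic = f^`()%classic by rewrite derive1nS derive1n1.
pose k t := f^`()%classic t / f t.
have dln t : is_derive t 1 (@ln R \o f) (k t).
  rewrite /k mulrC; apply: is_derive1_comp; first exact: is_derive1_ln.
  by rewrite derive1E; exact: derivableP.
have ck : continuous (fun t => `|k t|).
  move=> t; apply: cvg_norm; apply: cvgM; first by rewrite -f2; exact: cF2.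
  by apply: cvgV; [rewrite gt_eqF|exact: cf].
have [||c _ hc] := @EVT_max R (fun t => `|k t|) (-1) 2; first by lra.
  exact: continuous_subspaceT.
exists `|k c| => //.
have main s t : -1 <= s -> s < t -> t <= 2 ->
    `|ln (f s) - ln (f t)| <= `|k c| * `|s - t|.
  move=> s1 st t2.
  have cl : {within `[s, t], continuous (@ln R \o f)}.
    apply: continuous_subspaceT => z.
    by apply/differentiable_continuous/derivable1_diffP; have [] := dln z.
  have [z] := MVT st (fun z _ => dln z) cl.
  rewrite in_itv /= => /andP[z1 z2] e.
  rewrite distrC (distrC s) -[ln (f t)]/((@ln R \o f) t) e normrM ler_wpM2r//.
  by apply: hc; rewrite in_itv /=; apply/andP; split; lra.
have red t : ln (f t) = ln (f (t - (Num.floor t)%:~R)).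
  by rewrite -mulrNz Fp.
have fl t : 0 <= t - (Num.floor t)%:~R < 1.
  by have := floor_itv t; rewrite intrD1 => /andP[? ?]; apply/andP; split; lra.
have main' s t : s < t -> `|ln (f s) - ln (f t)| <= `|k c| * `|s - t|.
  move=> st; have [ts|ts] := leP (t - s) 1.
    have /andP[a b] := fl s.
    have -> : ln (f t) = ln (f (t - (Num.floor s)%:~R)) by rewrite -mulrNz Fp.
    rewrite red (_ : s - t = (s - (Num.floor s)%:~R) - (t - (Num.floor s)%:~R)); last by ring.
    by apply: main; lra.
  have /andP[a b] := fl s; have /andP[a' b'] := fl t.
  rewrite red [ln (f t)]red.
  have aux u v : 0 <= u < 1 -> 0 <= v < 1 -> `|ln (f u) - ln (f v)| <= `|k c|.
    move=> /andP[? ?] /andP[? ?]; case: (ltgtP u v) => uv.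
    - rewrite (le_trans (main u v _ _ _))//; try lra.
      by rewrite ler_piMr// ltr0_norm; lra.
    - rewrite distrC (le_trans (main v u _ _ _))//; try lra.
      by rewrite ler_piMr// ltr0_norm; lra.
    - by rewrite uv subrr normr0.
  rewrite (le_trans (aux _ _ (fl s) (fl t)))// ler_peMr//.
  by rewrite distrC gtr0_norm ?subr_gt0// ltW.
move=> s t; case: (ltgtP s t) => [/main'//|/main'|->].
  by rewrite (distrC t) (distrC (ln (f t))).
by rewrite !subrr normr0 mulr0.
Qed.

(** A lift [F0] satisfies [F0 (t + 1) = F0 t + d] for an integer [d], its degree,
    which is positive as the derivative is.  Degrees multiply under composition,
    and the inverse of [g] has a degree too, so that [d = 1]. *)
Lemma Diff2_lift g F : Diff2_plus g -> is_lift g F ->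
  line_diffeo F /\ forall t, F^`()%classic t = circle_deriv g (circle_pi t).
Proof.
move=> [[F0 lF0 cF0] [[h [[H0 [cH0 eH0] _] gh hg]] pos]] lF.
have F0d t : derivable F0 t 1 by exact: cF0.1 0%N t isT.
have [cF0' eF0] := lF0; have [cF eF] := lF.
have addc K : is_lift g K -> exists n : int, K = fun t => F0 t + n%:~R.
  move=> [cK eK]; have [n hn] := lift_unique cK cF0' (fun t => etrans (eK t) (esym (eF0 t))).
  by exists n; apply/funext.
have deraddc (c : R) : (fun t => F0 t + c)^`()%classic = F0^`()%classic.
  apply/funext => t; rewrite !derive1E.
  have h1 : is_derive t 1 F0 ('D_1 F0 t) by exact: derivableP.
  have h2 : is_derive t 1 (cst c : R -> R) 0 by exact: is_derive_cst.
  have := is_deriveD h1 h2; rewrite addr0 => h3.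
  exact: (@derive_val _ _ _ _ _ _ _ h3).
have lL : is_lift g (circle_lift g) by apply: (@getPex _ (is_lift g)); exists F0.
have [nL eL] := addc _ lL; have [nF eFF] := addc _ lF.
have shiftF (e : R) : continuous (fun t => F0 (t + e)).
  move=> t; apply: (@continuous_comp _ _ _ (fun t => t + e) F0); last exact: cF0'.
  by apply: cvgD; [exact: cvg_id|exact: cvg_cst].
have [d hd] : exists d : int, forall t, F0 (t + 1) = F0 t + d%:~R.
  apply: lift_unique => // t; rewrite !eF0; congr g.
  exact: (circle_pi_addz t 1).
have F0z t (n : int) : F0 (t + n%:~R) = F0 t + (d * n)%:~R.
  have nat_case (k : nat) u : F0 (u + k%:R) = F0 u + (d * k%:Z)%:~R.
    elim: k => [|k IH]; first by rewrite mulr0 !addr0.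
    by rewrite -natr1 addrA hd IH -addrA -intrD -[k.+1]addn1 PoszD mulrDr mulr1.
  case: n => n; first exact: nat_case.
  have := nat_case n.+1 (t - n.+1%:R); rewrite subrK NegzE => ->.
  by rewrite -addrA -intrD -mulrDr subrr mulr0 addr0 mulrNz.
have derz t (n : int) : F0^`()%classic (t + n%:~R) = F0^`()%classic t.
  rewrite !derive1E /derive.
  suff -> : (fun k : R => k^-1 *: ((F0 \o shift (t + n%:~R)) (k *: 1) -
    F0 (t + n%:~R))) = (fun k => k^-1 *: ((F0 \o shift t) (k *: 1) - F0 t)) by [].
  apply/funext => k /=; congr (_ *: _).
  by rewrite addrA !F0z opprD addrACA subrr addr0.
have der t : F0^`()%classic t = circle_deriv g (circle_pi t).
  rewrite /circle_deriv eL deraddc.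
  have /circle_pi_eq[n ->] : circle_pi (repr (circle_pi t)) = circle_pi t by exact: circle_pi_repr.
  by rewrite derz.
have der0 t : 0 < F0^`()%classic t by rewrite der.
have mono s t : s < t -> F0 s < F0 t.
  move=> st; have [||z _ e] := @MVT _ F0 (F0^`()%classic) s t st.
  - by move=> z _; rewrite derive1E; exact: derivableP.
  - exact: continuous_subspaceT.
  by rewrite -subr_gt0 e mulr_gt0 ?subr_gt0.
have d1 : d = 1.
  have d0 : 0 < d.
    by have := mono 0 1 ltr01; rewrite -[1]add0r hd ltrDl ltr0z.
  have [n hn] : exists n : int, forall t, F0 (H0 t) = t + n%:~R.
    apply: lift_unique; last by move=> t; rewrite eF0 eH0 hg.
      by move=> t; apply: continuous_comp; [exact: cH0|exact: cF0'].
    by move=> t; exact: cvg_id.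
  have /circle_pi_eq[e he] : circle_pi (H0 1) = circle_pi (H0 0).
    by rewrite !eH0; congr h; have := circle_pi_addz 0 1; rewrite add0r.
  have := hn 1; rewrite he F0z hn add0r addrC => /addIr /eqP.
  rewrite -[1]/(1%:~R) eqr_int => /eqP de.
  have := congr1 absz de; rewrite abszM => /eqP; rewrite muln_eq1 => /andP[/eqP d1 _].
  by rewrite -(gtz0_abs d0) d1.
have dF0 : line_diffeo F0.
  split => //; first exact: C2_log_lipschitz.
  by move=> t; rewrite hd d1.
rewrite eFF; split; first by have [] := line_diffeo_addc nF%:~R dF0.
by move=> t; rewrite deraddc der.
Qed.

Definition lifts (G : set (circle R -> circle R)) : set (R -> R) :=
  [set F | exists2 g, G g & is_lift g F].

Section Group.
Variable G : set (circle R -> circle R).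
Hypotheses (GD : G `<=` @Diff2_plus R) (grG : is_group G).

Lemma exists_lift g : G g -> exists F, is_lift g F.
Proof. by move=> /GD[[F lF _] _]; exists F. Qed.

Lemma lifts_group : lift_group (lifts G).
Proof.
have [Gid Gcomp Ginv] := grG; split.
- by move=> F [g /GD Dg lF]; have [] := Diff2_lift Dg lF.
- move=> F H [f Gf [cF eF]] [h Gh [cH eH]]; exists (f \o h); first exact: Gcomp.
  split; last by move=> t /=; rewrite eF eH.
  by move=> t; apply: continuous_comp; [exact: cH|exact: cF].
- move=> F [g Gg lF]; have [h [Gh gh hg]] := Ginv g Gg.
  have [dF _] := Diff2_lift (GD Gg) lF; have [cF eF] := lF.
  have [H0 [cH0 eH0]] := exists_lift Gh.
  have [n hn] : exists n : int, forall t, F (H0 t) = t + n%:~R.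
    apply: lift_unique; last by move=> t; rewrite eF eH0 hg.
      by move=> t; apply: continuous_comp; [exact: cH0|exact: cF].
    by move=> t; exact: cvg_id.
  pose H t := H0 (t + (- n)%:~R).
  have HK : cancel H F by move=> t; rewrite /H hn mulrNz subrK.
  exists H; split => //.
    exists h => //; split; last by move=> t; rewrite /H eH0 circle_pi_addz.
    move=> t; apply: (@continuous_comp _ _ _ (fun t => t + (- n)%:~R) H0); last exact: cH0.
    by apply: cvgD; [exact: cvg_id|exact: cvg_cst].
  by move=> t; apply: (line_diffeo_inj dF); rewrite HK.
- move=> n; exists id => //; split; last by move=> t; rewrite circle_pi_addz.
  by move=> t; apply: cvgD; [exact: cvg_id|exact: cvg_cst].
Qed.

Lemma group_continuous g : G g -> continuous g.
Proof.
move=> /exists_lift[F [cF eF]]; apply/quotient_continuous.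
have -> : g \o \pi_(circle R)%qT = @circle_pi R \o F by apply/funext => t /=; rewrite eF.
by move=> t; apply: continuous_comp; [exact: cF|exact: circle_pi_continuous].
Qed.

End Group.
End CircleLifts.

(** * Minimal sets *)

Section MinimalSets.
Context {R : realType}.
Implicit Types (F H : R -> R) (s t : R) (x y : circle R) (g : circle R -> circle R).
Variable G : set (circle R -> circle R).
Hypotheses (GD : G `<=` @Diff2_plus R) (grG : is_group G).

Let gL := lifts_group GD grG.
Let dL := lift_group_diffeo gL.

Lemma invariant_setP (A : set (circle R)) :
  (forall g x, G g -> A x -> A (g x)) <-> invariant_set G A.
Proof.
have [_ _ Ginv] := grG; split => [h g Gg|h g x Gg Ax].
  apply/seteqP; split => [_ [x Ax <-]|x Ax]; first exact: h.
  by have [f [Gf gf fg]] := Ginv g Gg; exists (f x); [exact: h|exact: fg].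
by rewrite -(h g Gg); exists x.
Qed.

Section Lift.
Variable L : set (circle R).
Hypothesis Lmin : minimal_set G L.

Lemma lift_closed : closed (@circle_pi R @^-1` L).
Proof. by apply/circle_closedP; have [] := Lmin. Qed.

Lemma lift_invariant F t : lifts G F ->
  (@circle_pi R @^-1` L) t -> (@circle_pi R @^-1` L) (F t).
Proof.
have [_ _ /invariant_setP inv _] := Lmin.
by move=> [g Gg [_ eF]] Lt; rewrite /preimage /= eF; exact: inv.
Qed.

(** The closure of an orbit in [L] is invariant, hence equal to [L]; integer
    translations adjust the lift. *)
Lemma orbit_dense s t (e : R) : (@circle_pi R @^-1` L) s ->
  (@circle_pi R @^-1` L) t -> 0 < e -> exists2 F, lifts G F & `|F s - t| < e.
Proof.
have [L0 cL /invariant_setP inv Lm] := Lmin; have [Gid Gcomp Ginv] := grG.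
move=> Ls Lt e0; set x := circle_pi s in Ls.
pose O : set (circle R) := [set g x | g in G].
have OL : O `<=` L by move=> _ [g Gg <-]; exact: inv.
have cO : closure O = L.
  apply: Lm.
  - by exists x; apply: subset_closure; exists id.
  - exact: closed_closure.
  - apply/invariant_setP => g z Gg cz B Bgz.
    have [w [[f Gf <-] Bw]] := cz _ (group_continuous GD Gg Bgz).
    by exists (g (f x)); split => //; exists (g \o f) => //; exact: Gcomp.
  - by move=> z cz; apply: cL; exact: closure_subset OL _ cz.
have : closure O (circle_pi t) by rewrite cO.
move=> /(_ (@circle_pi R @` ball t e)) [].
  apply: open_nbhs_nbhs; split; first by apply: circle_pi_open; exact: ball_open.
  by exists t => //; exact: ballxx.
move=> _ [[g Gg <-] [u ut gu]].
have [F lF] := exists_lift GD Gg.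
have /circle_pi_eq[n nF] : circle_pi u = circle_pi (F s) by rewrite lF.2.
exists (fun r => F r + n%:~R); first by exists g => //; exact: lift_shift.
by rewrite -nF distrC.
Qed.

Lemma circle_shift_pi t (e : R) : circle_shift (circle_pi t) e = circle_pi (t + e).
Proof.
rewrite /circle_shift.
have /circle_pi_eq[n ->] : circle_pi (repr (circle_pi t)) = circle_pi t by exact: circle_pi_repr.
by rewrite addrAC circle_pi_addz.
Qed.

Lemma isolated_fixed_parabolic t : isolated_fixed G (circle_pi t) ->
  parabolic_fixed (lifts G) t.
Proof.
move=> [gp [gm [Gp Gm fp fm [[e1 e10 h1] [e2 e20 h2]]]]].
have fixing g : G g -> g (circle_pi t) = circle_pi t ->
    exists F, [/\ lifts G F, F t = t & forall s, F s = s -> Fix g (circle_pi s)].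
  move=> Gg fg; have [F lF] := exists_lift GD Gg.
  have /circle_pi_eq[n nF] : circle_pi t = circle_pi (F t) by rewrite lF.2.
  exists (fun r => F r + n%:~R); split => //.
    by exists g => //; exact: lift_shift.
  by move=> s es; have [_ eF] := lift_shift n lF; rewrite /Fix /= -eF es.
have [F [lF Ft FF]] := fixing gp Gp fp; have [H [lH Ht HH]] := fixing gm Gm fm.
exists F, H, (Num.min e1 e2); split => //.
- by rewrite lt_min e10.
- move=> s /andP[ts]; rewrite -ltrBlDl lt_min => /andP[s1 _] /FF.
  have := h1 (s - t); rewrite circle_shift_pi [t + _]addrC subrK; apply.
  by rewrite subr_gt0 ts.
- move=> s /andP[+ st]; rewrite ltrBlDr -ltrBlDl lt_min => /andP[_ s2] /HH.
  have := h2 (t - s); rewrite circle_shift_pi opprB (_ : t + (s - t) = s); last by lra.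
  apply.
  by rewrite subr_gt0 st.
Qed.

Lemma lift_locally_expandable t : (NE G (circle_pi t) -> isolated_fixed G (circle_pi t)) ->
  locally_expandable (lifts G) t.
Proof.
move=> h; have [/h/isolated_fixed_parabolic|nNE] := pselect (NE G (circle_pi t)).
  by right.
left; have [g Gg /negP gt] : exists2 g, G g & ~ circle_deriv g (circle_pi t) <= 1.
  apply: contrapT => no; apply: nNE => g Gg.
  by apply: contrapT => h1; apply: no; exists g.
have [F lF] := exists_lift GD Gg.
exists F; first by exists g.
by have [_ ->] := Diff2_lift (GD Gg) lF; rewrite ltNge.
Qed.

End Lift.

(** Two distinct minimal sets would be separated by gaps: arcs that run from
    the first to the second one without meeting the first one in between.  Their
    left ends form a discrete closed invariant subset of the first minimal set. *)
Lemma distinct_minimal_isolated (L1 L2 : set (circle R)) :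
  minimal_set G L1 -> minimal_set G L2 -> L1 <> L2 ->
  forall s, L1 (circle_pi s) ->
    exists2 e : R, 0 < e & forall t, L1 (circle_pi t) -> `|t - s| < e -> t = s.
Proof.
move=> m1 m2 ne.
have [[x1 L1x1] c1 /invariant_setP i1 M1] := m1.
have [[x2 L2x2] c2 /invariant_setP i2 M2] := m2.
have disj x : L1 x -> L2 x -> False.
  move=> h1 h2; apply: ne.
  have inv : invariant_set G (L1 `&` L2).
    by apply/invariant_setP => g z Gg [? ?]; split; [exact: i1|exact: i2].
  have ne0 : L1 `&` L2 !=set0 by exists x.
  have cI := closedI c1 c2.
  rewrite -(M1 _ ne0 cI inv (@subIsetl _ _ _)).
  exact: (M2 _ ne0 cI inv (@subIsetr _ _ _)).
pose P1 t := L1 (circle_pi t); pose P2 t := L2 (circle_pi t).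
have cP1 : closed (P1 : set R) by exact: lift_closed m1.
have cP2 : closed (P2 : set R) by exact: lift_closed m2.
pose T : set R := [set t | P1 t /\ exists u, [/\ t < u, P2 u &
  forall z, t < z < u -> ~ P1 z]].
have Tinv F t : lifts G F -> T t -> T (F t).
  move=> lF [Pt [u [tu Pu no]]]; split; first exact: (lift_invariant m1 lF).
  have dF := dL lF; have [H [lH FH HF]] := lift_group_inv gL lF.
  exists (F u); split; [by rewrite line_diffeo_lt|exact: (lift_invariant m2 lF)|].
  move=> z /andP[z1 z2] Pz; apply: (no (H z)); last exact: (lift_invariant m1 lH).
  by apply/andP; split; rewrite -(line_diffeo_lt dF) HF.
have far t : ~ P2 t -> exists2 e : R, 0 < e & forall u, `|u - t| < e -> ~ P2 u.
  move=> nP; have : nbhs t (~` (P2 : set R)).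
    by apply: open_nbhs_nbhs; split => //; rewrite openC.
  by move=> /nbhs_ballP[e e0 h]; exists e => // u ut; apply: h; rewrite /ball /= distrC.
have sep t (e : R) : (forall u, `|u - t| < e -> ~ P2 u) -> forall a b, T a -> T b ->
    `|a - t| < e -> `|b - t| < e -> a = b.
  move=> noP; have main a b : T a -> T b -> `|a - t| < e -> `|b - t| < e -> ~ a < b.
    move=> [Pa [u [au Pu no]]] [Pb _] + + ab.
    have ub : u <= b by rewrite leNgt; apply/negP => bu; apply: (no b) => //; rewrite ab.
    rewrite !ltr_norml => /andP[? ?] /andP[? ?]; apply: (noP u) => //.
    by rewrite ltr_norml; apply/andP; split; lra.
  by move=> a b Ta Tb ha hb; case: (ltgtP a b) => // h; exfalso;
    [apply: (main a b)|apply: (main b a)].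
have T0 : T !=set0.
  pose u := repr x2; have Pu : P2 u by rewrite /P2 circle_pi_repr.
  pose S : set R := [set t | P1 t /\ t <= u].
  have S0 : S !=set0.
    pose v := repr x1; have Pv : P1 v by rewrite /P1 circle_pi_repr.
    exists (v + (- (`|Num.floor (v - u)| + 1)%R)%:~R); split.
      by rewrite /P1 circle_pi_addz.
    have := floor_itv (v - u); rewrite intrD1 => /andP[_ h].
    have : (Num.floor (v - u))%:~R <= (`|Num.floor (v - u)|%R)%:~R :> R.
      by rewrite ler_int ler_norm.
    by rewrite mulrNz intrD; lra.
  have ubS : has_ubound S by exists u => t [].
  have supu : sup S <= u by apply: ge_sup => // t [].
  have P1s : P1 (sup S).
    apply: contrapT => nP.
    have : nbhs (sup S) (~` (P1 : set R)).
      by apply: open_nbhs_nbhs; split => //; rewrite openC.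
    move=> /nbhs_ballP[e e0 h].
    have [t [Pt tu] te] := sup_adherent e0 (conj S0 ubS).
    apply: (h t _ Pt); rewrite /ball /=.
    have ts : t <= sup S by apply: ub_le_sup => //; split.
    by rewrite ger0_norm; lra.
  exists (sup S); split => //; exists u; split => //.
    rewrite lt_neqAle supu andbT; apply/eqP => e.
    by apply: (disj (circle_pi u)) => //; rewrite -e.
  move=> z /andP[z1 z2] Pz.
  have : z <= sup S by apply: ub_le_sup => //; split => //; exact: ltW.
  by rewrite leNgt z1.
have cT : closed T.
  move=> t clt; have Pt : P1 t.
    by apply: cP1; apply: closure_subset clt => u [].
  have [e e0 noP] := far t (fun h => disj _ Pt h).
  apply: contrapT => nT.
  have [a [Ta ae]] := clt _ (nbhsx_ballx t e e0).
  have at0 : 0 < `|a - t|.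
    by rewrite normr_gt0 subr_eq0; apply/eqP => e1; apply: nT; rewrite -e1.
  have [b [Tb be]] := clt _ (nbhsx_ballx t _ at0).
  rewrite /ball /= distrC in ae; rewrite /ball /= distrC in be.
  have ab : a = b by apply: (sep t e noP) => //; exact: lt_trans be ae.
  by rewrite ab ltxx in be.
have TE : @circle_pi R @` T = L1.
  have preT : @circle_pi R @^-1` (@circle_pi R @` T) = T.
    apply/seteqP; split => [t [u Tu /esym/circle_pi_eq[n ->]]|t Tt]; last by exists t.
    exact: (Tinv _ _ (lift_group_shift gL n)).
  apply: M1.
  - by have [t Tt] := T0; exists (circle_pi t), t.
  - by apply/circle_closedP; rewrite preT.
  - apply/invariant_setP => g _ Gg [t Tt <-].
    have [F lF] := exists_lift GD Gg; rewrite -lF.2; exists (F t) => //.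
    by apply: Tinv => //; exists g.
  - by move=> _ [t [Pt _] <-].
have P1T t : P1 t -> T t.
  rewrite /P1 -TE => -[u Tu /esym/circle_pi_eq[n ->]].
  exact: (Tinv _ _ (lift_group_shift gL n)).
move=> s Ps; have [e e0 noP] := far s (fun h => disj _ Ps h).
exists e => // t Pt ts; apply: (sep s e noP) => //; try exact: P1T.
by rewrite subrr normr0.
Qed.

(** A Cantor set has no isolated point, whereas the presence of a second minimal
    set would make all points isolated. *)
Lemma exceptional_minimal_unique (L1 L2 : set (circle R)) :
  exceptional_minimal_set G L1 -> minimal_set G L2 -> L1 = L2.
Proof.
move=> [m1 [f [h [cf _ rf fh]]]] m2; apply: contrapT => ne.
pose c : cantor_space := point.
have Lc : L1 (f c) by rewrite -rf; exists c.
have [|e e0 iso] := distinct_minimal_isolated m1 m2 ne (s := repr (f c)).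
  by rewrite circle_pi_repr.
have /perfectTP/(_ c) := cantor_perfect; apply.
rewrite (_ : [set c] = f @^-1` (@circle_pi R @` ball (repr (f c)) e)).
  move/continuousP : cf; apply; apply: circle_pi_open; exact: ball_open.
apply/seteqP; split => [_ ->|d [t tc ft]].
  by exists (repr (f c)); [exact: ballxx|exact: circle_pi_repr].
have tE : t = repr (f c).
  apply: iso; last by rewrite distrC.
  by rewrite ft -rf; exists d.
by rewrite /= -(fh d) -ft tE circle_pi_repr fh.
Qed.

(** In the exceptional case the minimal set of the hypothesis is the given one, by
    uniqueness. *)
Lemma star_on_minimal_set (L : set (circle R)) :
  property_star G \/ property_Lambda_star G -> minimal_set G L ->
  forall x, L x -> NE G x -> isolated_fixed G x.
Proof.
move=> [[_ h] _ x _ /h //|[L' eL' h] mL x Lx NEx]; apply: h; split => //.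
by rewrite (exceptional_minimal_unique eL' mL).
Qed.

End MinimalSets.

(** * Lebesgue measure on the unit interval *)

Lemma measure_finite_union d (T : measurableType d) (R : realType)
  (mu : {measure set T -> \bar R}) (I : finType) (F : I -> set T) :
  (forall i, measurable (F i)) -> trivIset setT F ->
  mu (\bigcup_i F i) = (\sum_i mu (F i))%E.
Proof.
move=> mF tF; rewrite measure_fin_bigcup//; last exact: finite_finset.
rewrite (_ : setT = [set` index_enum I]); first by rewrite -fsbig_seq// index_enum_uniq.
by apply/seteqP; split => i //= _; rewrite mem_index_enum.
Qed.

Section UnitLebesgue.
Context {R : realType}.

Definition unit_lebesgue : set (measurableTypeR R) -> \bar R :=
  mrestr (@lebesgue_measure R) (measurable_itv `[(0 : R), 1[).

HB.instance Definition _ := Measure.on unit_lebesgue.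

Let unit_lebesgue_setT : unit_lebesgue setT = 1%E.
Proof.
by rewrite /unit_lebesgue /mrestr setTI lebesgue_measure_itv/= lte_fin ltr01 sube0.
Qed.

HB.instance Definition _ :=
  Measure_isProbability.Build _ _ _ unit_lebesgue unit_lebesgue_setT.

(** The right-hand side, as a function of [A], is a measure that agrees with
    Lebesgue measure on intervals. *)
Lemma lebesgue_affine (c p : R) (A : set R) : 0 < p -> measurable A ->
  lebesgue_measure A = (p%:E * lebesgue_measure ((fun u => (c + p * u)%R) @^-1` A))%E.
Proof.
move=> p0 mA.
have mf : @measurable_fun _ _ (measurableTypeR R) (measurableTypeR R) setT
    (fun u : R => c + p * u).
  apply: (@continuous_measurable_fun R) => u; apply: cvgD; first exact: cvg_cst.
  by apply: cvgM; [exact: cvg_cst|exact: cvg_id].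
pose f (u : measurableTypeR R) : measurableTypeR R := c + p * u.
pose m (h : measurable_fun setT f) : {measure set (measurableTypeR R) -> \bar R} :=
  mscale (NngNum (ltW p0)) (measure_function_pushforward__canonical__measure_function_Measure
    (@lebesgue_measure R) h).
rewrite (@lebesgue_measure_unique R (m mf))// => _ [[x y] _ <-] /=.
rewrite /m /mscale /= /pushforward /=.
have -> : (fun u => c + p * u) @^-1` `]x, y] = `](x - c) / p, (y - c) / p]%classic.
  apply/seteqP; split => u /=; rewrite !in_itv /= ltr_pdivrMr// ler_pdivlMr//;
    by rewrite ltrBlDl lerBrDl mulrC.
rewrite !lebesgue_measure_itv /= !lte_fin ltr_pM2r ?invr_gt0// ltrD2r.
case: ifPn => _; last by rewrite mule0.
by rewrite -!EFinD -EFinM; congr EFin; field; rewrite gt_eqF.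
Qed.

End UnitLebesgue.

(** * Coding of the limit set by the unit interval *)

Section Coding.
Context {R : realType}.
Variables (n : nat) (p : 'I_n -> R) (F : 'I_n -> R -> R) (a b : R) (C : set R) (z : R).
Hypotheses (p0 : forall i, 0 < p i) (p1 : \sum_i p i = 1).
Hypotheses (Fc : forall i, continuous (F i)).
Hypotheses (FI : forall i u, a <= u <= b -> a <= F i u <= b).
Hypotheses (FC : forall i u, C u -> C (F i u)).
Hypotheses (FL : forall i u v, a <= u <= b -> a <= v <= b ->
  `|F i u - F i v| <= 2^-1 * `|u - v|).
Hypotheses (cC : closed C) (Cz : C z) (zI : a <= z <= b).

Definition cumul (k : nat) : R := \sum_(j < n | (j < k)%N) p j.

Definition digit_itv (i : 'I_n) : set R := `[cumul i, cumul i.+1[%classic.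

Lemma cumul0 : cumul 0 = 0.
Proof. by rewrite /cumul big_pred0. Qed.

Lemma cumuln : cumul n = 1.
Proof. by rewrite -p1 /cumul; apply: eq_bigl => j; rewrite ltn_ord. Qed.

Lemma cumulS (i : 'I_n) : cumul i.+1 = cumul i + p i.
Proof.
rewrite /cumul (bigD1 i) /=; last by rewrite ltnS.
rewrite addrC; congr (_ + _); apply: eq_bigl => j.
by rewrite ltnS ltn_neqAle andbC.
Qed.

Lemma cumul_le k l : (k <= l)%N -> cumul k <= cumul l.
Proof.
move=> kl; rewrite /cumul [leRHS]big_mkcond [leLHS]big_mkcond; apply: ler_sum => j _.
by case: ifPn => [jk|_]; [rewrite (leq_trans jk kl)|case: ifPn => // _; exact: ltW].
Qed.

Lemma digit_itv_sub i u : digit_itv i u -> 0 <= u < 1.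
Proof.
rewrite /digit_itv /= in_itv /= => /andP[u0 u1].
rewrite (le_trans _ u0) ?(lt_le_trans u1)//.
  by rewrite -cumuln; exact: cumul_le.
by rewrite -cumul0; exact: cumul_le.
Qed.

Lemma digit_itv_disj i j u : digit_itv i u -> digit_itv j u -> i = j.
Proof.
rewrite /digit_itv /= !in_itv /= => /andP[i0 i1] /andP[j0 j1].
apply/val_inj/eqP; rewrite eqn_leq; apply/andP; split; rewrite leqNgt; apply/negP => /cumul_le.
  by rewrite leNgt (le_lt_trans i0).
by rewrite leNgt (le_lt_trans j0).
Qed.

Lemma digit_itv_cover u : 0 <= u < 1 -> exists i, digit_itv i u.
Proof.
move=> /andP[u0 u1].
have [k kn uk] : exists2 k, (k <= n)%N & u < cumul k by exists n => //; rewrite cumuln.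
elim: k kn uk => [|k IH] kn uk; first by rewrite cumul0 ltNge u0 in uk.
have [/(IH (ltnW kn))//|ku] := ltP u (cumul k).
by exists (Ordinal kn); rewrite /digit_itv /= in_itv /= ku.
Qed.

Definition digit_map (i : 'I_n) (u : R) : R := cumul i + p i * u.

Lemma digit_mapP i u : digit_itv i (digit_map i u) <-> 0 <= u < 1.
Proof.
rewrite /digit_itv /digit_map /= in_itv /= cumulS lerDl pmulr_rge0// ltrD2l.
by rewrite gtr_pMr.
Qed.

(** The unit interval is cut into consecutive intervals of lengths [p i]; a point of
    the [i]-th one is sent into the image of [F i], and rescaling the interval to
    the unit interval gives the next digit. *)
Fixpoint code_approx (m : nat) (u : R) : R :=
  if m is m'.+1 then
    \sum_(i < n) \1_(digit_itv i) u * F i (code_approx m' ((u - cumul i) / p i))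
  else z.

Lemma code_approxS m i u : 0 <= u < 1 ->
  code_approx m.+1 (digit_map i u) = F i (code_approx m u).
Proof.
move=> u01; have iu := (digit_mapP i u).2 u01.
rewrite /= (bigD1 i) //= big1 => [|j ji].
  rewrite addr0 indicE mem_set// mul1r; congr (F i (code_approx m _)).
  by rewrite /digit_map addrC addKr mulrC mulKf// gt_eqF.
rewrite indicE memNset ?mul0r// => /(digit_itv_disj iu) ij.
by rewrite ij eqxx in ji.
Qed.

Lemma digit_decomp u : 0 <= u < 1 -> exists i v, 0 <= v < 1 /\ u = digit_map i v.
Proof.
move=> u01; have [i iu] := digit_itv_cover u01.
exists i, ((u - cumul i) / p i).
have e : digit_map i ((u - cumul i) / p i) = u.
  by rewrite /digit_map mulrC divfK ?gt_eqF// addrC subrK.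
by split; [apply/(digit_mapP i); rewrite e|rewrite e].
Qed.

Lemma code_approx_in m u : 0 <= u < 1 ->
  a <= code_approx m u <= b /\ C (code_approx m u).
Proof.
elim: m u => [//|m IH] u /digit_decomp[i [v [v01 ->]]].
rewrite code_approxS//; have [h1 h2] := IH v v01.
by split; [exact: FI|exact: FC].
Qed.

Lemma code_approx_dist m k u : 0 <= u < 1 ->
  `|code_approx (m + k) u - code_approx m u| <= 2^-1 ^+ m * (b - a).
Proof.
elim: m u => [|m IH] u u01.
  have [/andP[? ?] _] := code_approx_in (0 + k) u01.
  by move: zI => /andP[? ?]; rewrite expr0 mul1r /= ler_norml; apply/andP; split; lra.
have [i [v [v01 ->]]] := digit_decomp u01.
rewrite addSn !code_approxS// (le_trans (FL _ _ _))//.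
- by have [] := code_approx_in (m + k) v01.
- by have [] := code_approx_in m v01.
by rewrite exprS -mulrA ler_wpM2l// IH.
Qed.

Lemma code_approx_out m u : ~ (0 <= u < 1) -> code_approx m.+1 u = 0.
Proof.
move=> nu; rewrite /= big1// => i _; rewrite indicE memNset ?mul0r//.
by move=> /digit_itv_sub.
Qed.

Definition code u := lim (code_approx ^~ u @ \oo).

Lemma code_cvg u : code_approx ^~ u @ \oo --> code u.
Proof.
have [u01|nu] := pselect (0 <= u < 1); last first.
  apply/cvg_ex; exists 0; rewrite -cvg_shiftS.
  rewrite (_ : (fun m => code_approx m.+1 u) = (fun=> 0)); first exact: cvg_cst.
  by apply/funext => m; exact: code_approx_out.
apply/cauchy_cvgP/cauchyP => e e0.
have /cvgrPdist_lt/(_ e e0)[N _ hN] : (fun m => 2^-1 ^+ m * (b - a)) @ \oo --> (0 : R).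
  rewrite -(mul0r (b - a)); apply: cvgMl; apply: cvg_expr.
  by rewrite ger0_norm ?invr_ge0// invf_lt1// ltr1n.
exists (code_approx N u); exists N => // m /= Nm.
rewrite /ball /= distrC -(subnKC Nm) (le_lt_trans (code_approx_dist N _ u01))//.
have := hN N (leqnn N); rewrite /= sub0r normrN ger0_norm// mulr_ge0 ?exprn_ge0 ?invr_ge0//.
by rewrite subr_ge0; move: zI => /andP[]; exact: le_trans.
Qed.

Lemma code_in u : 0 <= u < 1 -> a <= code u <= b /\ C (code u).
Proof.
move=> u01; split; last first.
  apply: (@closed_cvg _ _ \oo _ (code_approx ^~ u) C _ _ _ (code_cvg (u := u))) => //.
  by apply: nearW => m; have [] := code_approx_in m u01.
have := @closed_cvg _ _ \oo _ (code_approx ^~ u) `[a, b]%classic.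
have cI : closed (`[a, b]%classic : set R) by exact: itv_closed.
have nr : \forall m \near \oo, (`[a, b]%classic : set R) (code_approx m u).
  by apply: nearW => m; rewrite /= in_itv /=; have [] := code_approx_in m u01.
by move=> /(_ _ cI nr (code u) (code_cvg (u := u))); rewrite /= in_itv.
Qed.

Lemma code_digit_map i u : 0 <= u < 1 -> code (digit_map i u) = F i (code u).
Proof.
move=> u01; apply/cvg_lim => //; rewrite -cvg_shiftS.
rewrite (_ : (fun m => _) = F i \o (code_approx ^~ u)).
  by apply: continuous_cvg; [exact: Fc|exact: code_cvg].
by apply/funext => m /=; rewrite -code_approxS.
Qed.

Lemma measurable_code : measurable_fun [set: R] code.
Proof.
apply: (@measurable_realfun.measurable_fun_cvg _ _ _ _ code_approx) => [m|u _]; last exact: code_cvg.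
elim: m => [|m IH]; first exact: measurable_cst.
apply: measurable_sum => i; apply: measurable_funM.
  by apply: measurable_indic; exact: measurable_itv.
have mF : measurable_fun [set: R] (F i) by exact: continuous_measurable_fun.
apply: (measurableT_comp mF).
apply: (measurableT_comp IH).
apply: continuous_measurable_fun => u; apply: cvgM; last exact: cvg_cst.
by apply: cvgB; [exact: cvg_id|exact: cvg_cst].
Qed.

(** Self-similarity of Lebesgue measure, which the coding transports to the limit
    set of the maps [F i]. *)
Lemma unit_lebesgue_digits (B : set R) : measurable B ->
  unit_lebesgue B = (\sum_(i < n) (p i)%:E * unit_lebesgue (digit_map i @^-1` B))%E.
Proof.
move=> mB; rewrite /unit_lebesgue /mrestr.
have -> : B `&` `[0, 1[ = \bigcup_i (B `&` digit_itv i).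
  apply/seteqP; split => u.
    by move=> [Bu]; rewrite /= in_itv /= => /digit_itv_cover[i iu]; exists i.
  by move=> [i _ [Bu /digit_itv_sub]]; rewrite /= in_itv.
rewrite measure_finite_union; last 2 first.
  by move=> i; apply: measurableI => //; exact: measurable_itv.
  by move=> i j _ _ [u [[_ iu] [_ ju]]]; exact: digit_itv_disj iu ju.
apply: eq_bigr => i _.
rewrite [LHS](@lebesgue_affine R (cumul i) (p i))//; last first.
  by apply: measurableI => //; exact: measurable_itv.
congr (_ * lebesgue_measure _)%E; apply/seteqP; split => u /=.
  by move=> [Bu /(digit_mapP i)]; rewrite in_itv.
by rewrite in_itv /= => -[Bu /(digit_mapP i)].
Qed.

End Coding.

(** * Self-similar measures on the circle *)

Section CircleMeasurability.
Context {R : realType}.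

Lemma open_measurable_circle (A : set (circle R)) : open A ->
  measurable (A : set (borel_circle R)).
Proof. by move=> oA; exact: sub_sigma_algebra. Qed.

Lemma closed_measurable_circle (A : set (circle R)) : closed A ->
  measurable (A : set (borel_circle R)).
Proof.
move=> cA; rewrite -[A]setCK; apply: measurableC.
by apply: open_measurable_circle; rewrite openC.
Qed.

Lemma measurable_preimage_circle d (T : measurableType d) (f : T -> circle R) :
  (forall B : set (circle R), open B -> measurable (f @^-1` B)) ->
  forall A : set (borel_circle R), measurable A -> measurable (f @^-1` A).
Proof.
move=> mf A mA.
have sM : sigma_algebra setT [set B : set (circle R) | measurable (f @^-1` B)].
  split => [|B|B mB] /=.
  - by rewrite preimage_set0; exact: measurable0.
  - by rewrite setTD preimage_setC => mB; exact: measurableC.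
  - by rewrite preimage_bigcup; exact: bigcupT_measurable.
exact: (smallest_sub sM mf) mA.
Qed.

Lemma measurable_continuous_preimage (g : circle R -> circle R) (A : set (borel_circle R)) :
  continuous g -> measurable A -> measurable (g @^-1` A : set (borel_circle R)).
Proof.
move=> /continuousP cg; apply: (@measurable_preimage_circle _ (borel_circle R)) => B oB.
by apply: open_measurable_circle; exact: cg.
Qed.

Lemma measurable_circle_pi :
  @measurable_fun _ _ (measurableTypeR R) (borel_circle R) setT (@circle_pi R).
Proof.
move=> _ A mA; rewrite setTI.
apply: (@measurable_preimage_circle _ (measurableTypeR R)) mA => B oB.
exact: open_measurable.
Qed.

End CircleMeasurability.

Section Stationary.
Context {R : realType}.
Variables (n : nat) (p : 'I_n -> R) (g : 'I_n -> circle R -> circle R).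

Definition weighted_stationary (nu : probability (borel_circle R) R) :=
  forall A : set (borel_circle R), measurable A ->
    nu A = (\sum_(i < n) (p i)%:E * nu (g i @^-1` A))%E.

Variables (F : 'I_n -> R -> R) (a b : R).
Hypotheses (ab : a < b < a + 2^-1).
Hypotheses (p0 : forall i, 0 < p i) (p1 : \sum_i p i = 1).
Hypotheses (gF : forall i, is_lift (g i) (F i)).
Hypotheses (FI : forall i u, a <= u <= b -> a <= F i u <= b).
Hypotheses (FL : forall i u v, a <= u <= b -> a <= v <= b ->
  `|F i u - F i v| <= 2^-1 * `|u - v|).

Definition arc : set (circle R) := @circle_pi R @` `[a, b].

Lemma arc_inj u v : a <= u <= b -> a <= v <= b -> circle_pi u = circle_pi v -> u = v.
Proof.
move=> /andP[u1 u2] /andP[v1 v2] /circle_pi_eq[m e]; move: ab => /andP[_ ab'].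
suff : m = 0 by move=> m0; rewrite e m0 addr0.
have : ((-1)%:~R < m%:~R :> R) && (m%:~R < 1%:~R :> R).
  by rewrite mulrNz; apply/andP; split; lra.
by rewrite !ltr_int; case: (m) => [[|k]|[|k]].
Qed.

Lemma arc_closed : closed arc.
Proof.
have oc : open (@circle_pi R @` `]b, a + 1[).
  by apply: circle_pi_open; exact: itv_open.
have -> : arc = ~` (@circle_pi R @` `]b, a + 1[); last by rewrite closedC.
have /andP[ab1 ab2] := ab.
apply/seteqP; split => [_ [u + <-] [v +]|x nx].
  rewrite /= !in_itv /= => /andP[u1 u2] /andP[v1 v2] /circle_pi_eq[m e].
  have : (0%:~R < m%:~R :> R) && (m%:~R < 1%:~R :> R).
    by apply/andP; split; lra.
  by rewrite !ltr_int; case: (m) => [[|k]|[|k]].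
pose t := repr x - (Num.floor (repr x - a))%:~R.
have tx : circle_pi t = x.
  by rewrite /t -mulrNz circle_pi_addz circle_pi_repr.
have := floor_itv (repr x - a); rewrite intrD1 => /andP[f1 f2].
have [tb|bt] := leP t b.
  by exists t => //; rewrite /= in_itv /= tb andbT /t; lra.
exfalso; apply: nx; exists t => //; rewrite /= in_itv /= bt /= /t; lra.
Qed.

Lemma measurable_arc : measurable (arc : set (borel_circle R)).
Proof. exact: closed_measurable_circle arc_closed. Qed.

Lemma g_continuous i : continuous (g i).
Proof.
apply/quotient_continuous.
rewrite (_ : g i \o _ = @circle_pi R \o F i); last first.
  by apply/funext => t /=; rewrite (gF i).2.
move=> t; apply: continuous_comp; last exact: circle_pi_continuous.
by have [cF _] := gF i; exact: cF.
Qed.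

Let mg i (A : set (borel_circle R)) : measurable A ->
  measurable (g i @^-1` A : set (borel_circle R)).
Proof. by apply: measurable_continuous_preimage; exact: g_continuous. Qed.

(** The measure is the image of Lebesgue measure on the unit interval under the
    coding map, which conjugates the digit maps to the [F i].  The set [L] has full
    measure because the coding starts at a point of [L]. *)
Lemma exists_weighted_stationary (L : set (circle R)) : closed L ->
  (forall i x, L x -> L (g i x)) -> L `&` arc !=set0 ->
  exists nu : probability (borel_circle R) R,
    [/\ weighted_stationary nu, nu arc = 1%E & nu L = 1%E].
Proof.
move=> cL Lg [x [Lz [z + zE]]]; rewrite /= in_itv /= => zab; rewrite -zE in Lz.
have cL' : closed (@circle_pi R @^-1` L) by exact/circle_closedP.
have FC i u : (@circle_pi R @^-1` L) u -> (@circle_pi R @^-1` L) (F i u).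
  by rewrite /preimage /= (gF i).2; exact: Lg.
have cF i : continuous (F i) by have [] := gF i.
pose X u : borel_circle R := circle_pi (code p F z u).
have mX : @measurable_fun _ _ (measurableTypeR R) (borel_circle R) setT X.
  apply: (measurableT_comp measurable_circle_pi).
  exact: (measurable_code p0 p1 cF FI FC FL Lz zab).
pose Xf := @mfun_Sub _ _ (measurableTypeR R) (borel_circle R) X (mem_set mX).
have Xin u : 0 <= u < 1 -> arc (X u) /\ L (X u).
  move=> u01; have [h1 h2] := code_in p0 p1 FI FC FL cL' Lz zab u01.
  by split => //; exists (code p F z u).
have full (A : set (borel_circle R)) : (forall u, 0 <= u < 1 -> A (X u)) ->
    distribution (@unit_lebesgue R) Xf A = 1%E.
  move=> hA; rewrite /distribution /= /pushforward /unit_lebesgue /mrestr.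
  rewrite (_ : _ `&` _ = `[(0:R), 1[%classic).
    by rewrite lebesgue_measure_itv/= lte_fin ltr01 sube0.
  apply/seteqP; split => u; first by case.
  by move=> uI; split => //; apply: hA; move: uI; rewrite /= in_itv.
exists (distribution (@unit_lebesgue R) Xf); split.
- move=> A mA; rewrite /distribution /= /pushforward.
  rewrite (@unit_lebesgue_digits R n p p0 p1); last first.
    by have := mX measurableT A mA; rewrite setTI.
  apply: eq_bigr => i _; congr (_ * _)%E; rewrite /unit_lebesgue /mrestr.
  congr (lebesgue_measure _); apply/seteqP; split => u /=; rewrite in_itv /= => -[h u01].
    split => //; move: h.
    by rewrite /X (code_digit_map p0 p1 cF FI FC FL Lz zab)// (gF i).2.
  split => //; move: h.
  by rewrite /X (code_digit_map p0 p1 cF FI FC FL Lz zab)// (gF i).2.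
- by apply: full => u /Xin[].
- by apply: full => u /Xin[].
Qed.

Section Measure.
Variable nu : probability (borel_circle R) R.
Hypotheses (st : weighted_stationary nu) (nu1 : nu arc = 1%E).

Lemma null_off_arc (A : set (borel_circle R)) : measurable A ->
  (forall x, arc x -> ~ A x) -> nu A = 0%E.
Proof.
move=> mA hA; apply/eqP; rewrite -measure_le0.
have -> : 0%E = nu (~` arc).
  by rewrite probability_setC ?nu1 ?subee//; exact: measurable_arc.
apply: le_measure; rewrite ?inE//; first by apply: measurableC; exact: measurable_arc.
by move=> x Ax arcx; exact: hA arcx Ax.
Qed.

Lemma le_measure_arc (A B : set (borel_circle R)) : measurable A -> measurable B ->
  A `&` arc `<=` B -> (nu A <= nu B)%E.
Proof.
move=> mA mB AB; have mK := measurable_arc.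
rewrite (measureDI nu mA mK) [X in (X + _ <= _)%E](_ : _ = 0%E) ?add0e; last first.
  by apply: null_off_arc; [exact: measurableD|move=> x ? []].
by apply: le_measure; rewrite ?inE//; exact: measurableI.
Qed.

Lemma null_off_images (A : set (borel_circle R)) : measurable A ->
  (forall i x, arc x -> ~ A (g i x)) -> nu A = 0%E.
Proof.
move=> mA hA; rewrite st// big1 // => i _.
by rewrite null_off_arc ?mule0//; [exact: mg|exact: hA].
Qed.

End Measure.

Definition arc_nbhd (e : R) (A : set (circle R)) : set (circle R) :=
  @circle_pi R @` [set t | exists u, [/\ a <= u <= b, A (circle_pi u) & `|t - u| < e]].

Lemma arc_nbhd_open e A : open (arc_nbhd e A).
Proof.
apply: circle_pi_open.
rewrite (_ : [set t | _] = \bigcup_(u in [set u | a <= u <= b /\ A (circle_pi u)]) ball u e).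
  by apply: bigcup_open => u _; exact: ball_open.
apply/seteqP; split => t; first by move=> [u [? ? tu]]; exists u => //; rewrite /ball /= distrC.
by move=> [u [? ?]]; rewrite /ball /= distrC => tu; exists u.
Qed.

(** Induction on [m]: by stationarity both measures are averages of their values on
    preimages under the [g i], and since [F i] contracts by [2^-1], a neighbourhood
    of the preimage of [A] lies in the preimage of a neighbourhood of half the
    size.  For [m = 0] the neighbourhood of any point of the arc is the whole
    arc. *)
Lemma weighted_stationary_le nu nu' (m : nat) (A : set (borel_circle R)) :
  weighted_stationary nu -> weighted_stationary nu' -> nu arc = 1%E -> nu' arc = 1%E ->
  measurable A -> (nu A <= nu' (arc_nbhd (2^-1 ^+ m.+1) A))%E.
Proof.
move=> st st' nu1 nu'1; have mnb e B : measurable (arc_nbhd e B : set (borel_circle R)).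
  by apply: open_measurable_circle; exact: arc_nbhd_open.
have /andP[ab1 ab2] := ab.
elim: m A => [|m IH] A mA.
  have [[_ [[u + <-] Au]]|nA] := pselect (exists x, arc x /\ A x); last first.
    rewrite (null_off_arc nu1)// => x ? ?; apply: nA; by exists x.
  rewrite /= in_itv /= => /andP[u1 u2].
  apply: (@le_trans _ _ 1%E); first exact: probability_le1.
  rewrite -nu'1; apply: le_measure; rewrite ?inE//; first exact: measurable_arc.
  move=> _ [t + <-]; rewrite /= in_itv /= => /andP[t1 t2]; exists t => //=.
  exists u; split => //; first by rewrite u1.
  by rewrite expr1 ltr_norml; apply/andP; split; lra.
rewrite st// [leRHS]st'//; apply: lee_sum => i _.
apply: lee_wpmul2l; first by rewrite lee_fin ltW.
apply: (le_trans (IH _ (mg i mA))); apply: (le_measure_arc nu'1) => //; first exact: mg.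
move=> _ [[t [u [uab Au tu]] <-] [t' t'ab tt']].
have tE : t = t'.
  move: t'ab uab tu; rewrite /= in_itv /= => /andP[? ?] /andP[? ?]; rewrite ltr_norml => /andP[? ?].
  have /circle_pi_eq[k e] := tt'.
  have h2 : 2^-1 ^+ m.+1 <= 2^-1 :> R.
    by rewrite exprS ler_piMr ?invr_ge0// exprn_ile1 ?invr_ge0// invf_le1// ler1n.
  have : ((-1)%:~R < k%:~R :> R) && (k%:~R < 1%:~R :> R).
    by rewrite mulrNz; apply/andP; split; lra.
  by rewrite !ltr_int e; case: (k) => [[|l]|[|l]]//; rewrite addr0.
rewrite /= -tE in t'ab *; rewrite in_itv /= in t'ab.
rewrite -(gF i).2; exists (F i t) => //; exists (F i u); split => //.
- exact: FI.
- by rewrite (gF i).2.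
rewrite (le_lt_trans (FL i t'ab uab))// exprS ltr_pM2l// invr_gt0//.
Qed.

(** Letting [m] grow, closed sets have the same measure by symmetry. *)
Lemma weighted_stationary_unique nu nu' :
  weighted_stationary nu -> weighted_stationary nu' -> nu arc = 1%E -> nu' arc = 1%E ->
  forall A : set (borel_circle R), measurable A -> nu A = nu' A.
Proof.
have main m1 m2 (C : set (circle R)) : closed C ->
  weighted_stationary m1 -> weighted_stationary m2 -> m1 arc = 1%E -> m2 arc = 1%E ->
  (m1 C <= m2 C)%E.
  move=> cC st st' e1 e2; have mC := closed_measurable_circle cC.
  pose nb (m : nat) : set (borel_circle R) := arc_nbhd (2^-1 ^+ m.+1) C.
  have mnb m : measurable (nb m) by apply: open_measurable_circle; exact: arc_nbhd_open.
  have mI : measurable (\bigcap_m nb m) by exact: bigcapT_measurable.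
  have cvg_nb : m2 \o nb @ \oo --> m2 (\bigcap_m nb m).
    apply: nonincreasing_cvg_mu => //.
      by rewrite (le_lt_trans (probability_le1 _ _))// ltry.
    apply/nonincreasing_seqP => m; apply/subsetPset => _ [t [u [? ? tu]] <-].
    exists t => //; exists u; split => //; rewrite (lt_le_trans tu)//.
    by rewrite [leLHS]exprS ler_piMl ?exprn_ge0 ?invr_ge0// invf_le1// ler1n.
  have h1 : (m1 C <= m2 (\bigcap_m nb m))%E.
    rewrite -(cvg_lim _ cvg_nb)//; apply: lime_ge; first by apply/cvg_ex; eexists; exact: cvg_nb.
    by apply: nearW => m; exact: weighted_stationary_le.
  apply: (le_trans h1); apply: le_measure; rewrite ?inE//.
  move=> x xI; apply: contrapT => nCx.
  have /circle_closedP cC' := cC.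
  pose t := repr x; have tx : circle_pi t = x by exact: circle_pi_repr.
  have : nbhs t (~` (@circle_pi R @^-1` C)).
    by apply: open_nbhs_nbhs; split; [rewrite openC|rewrite /setC /preimage /= tx].
  move=> /nbhs_ballP[e e0 he].
  have /cvgrPdist_lt/(_ e e0)[N _ hN] : (fun m => 2^-1 ^+ m.+1 : R) @ \oo --> (0 : R).
    rewrite cvg_shiftS; apply: cvg_expr.
    by rewrite ger0_norm ?invr_ge0// invf_lt1// ltr1n.
  have [t' [u [_ Cu t'u]] t'x] := xI N I.
  have /circle_pi_eq[k kE] : circle_pi t' = circle_pi t by rewrite t'x tx.
  apply: (he (u + (- k)%:~R)); last by rewrite /preimage /= circle_pi_addz.
  rewrite /ball /= (_ : t - _ = t' - u); last by rewrite kE mulrNz; ring.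
  apply: (lt_trans t'u); have := hN N (leqnn N).
  by rewrite /= sub0r normrN ger0_norm// exprn_ge0// invr_ge0.
move=> st st' nu1 nu'1 A mA.
apply: (@measure_unique _ R (borel_circle R) (@open (circle R)) (fun=> setT)) => //.
- by move=> B C; exact: openI.
- by move=> _; exact: openT.
- by rewrite bigcup_const//; exists 0%N.
- move=> B oB; have mB := open_measurable_circle oB.
  have cB : closed (~` B) by rewrite closedC.
  have e : nu (~` B) = nu' (~` B) by apply/eqP; rewrite eq_le !main.
  have : nu (~` ~` B) = nu' (~` ~` B).
    by rewrite (probability_setC nu (measurableC mB)) (probability_setC nu' (measurableC mB)) e.
  by rewrite setCK.
- by move=> _; rewrite (le_lt_trans (probability_le1 _ _))// ltry.
Qed.

End Stationary.

(** * Dimension of self-similar measures *)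

Section CircleDistance.
Context {R : realType}.

Let dist_set (x y : circle R) : set R :=
  [set r | exists s t, [/\ circle_pi s = x, circle_pi t = y & r = `|s - t|]].

Let dist_set_lb x y : has_lbound (dist_set x y).
Proof. by exists 0 => _ [s [t [_ _ ->]]]. Qed.

Lemma circle_dist_le (s t : R) : circle_dist (circle_pi s) (circle_pi t) <= `|s - t|.
Proof. by apply: (ge_inf (dist_set_lb _ _)); exists s, t. Qed.

Lemma circle_dist_ge (s t : R) : `|s - t| <= 2^-1 ->
  `|s - t| <= circle_dist (circle_pi s) (circle_pi t).
Proof.
move=> st; apply: lb_le_inf; first by exists `|s - t|, s, t.
move=> _ [s' [t' [/circle_pi_eq[m ->] /circle_pi_eq[k ->] ->]]].
have -> : s + m%:~R - (t + k%:~R) = (s - t) + (m - k)%:~R by rewrite mulrzBr; ring.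
have [->|mk] := eqVneq (m - k) 0; first by rewrite addr0.
have : 1 <= `|(m - k)%:~R| :> R.
  by rewrite -intr_norm -[1]/(1%:~R) ler_int -gtz0_ge1 normr_gt0.
have := ler_normB ((s - t) + (m - k)%:~R) (s - t).
by rewrite addrC addKr; lra.
Qed.

Lemma circle_pi_unit (x : circle R) : exists2 t : R, 0 <= t < 1 & circle_pi t = x.
Proof.
exists (repr x - (Num.floor (repr x))%:~R); last first.
  by rewrite -mulrNz circle_pi_addz circle_pi_repr.
by have := floor_itv (repr x); rewrite intrD1 => /andP[? ?]; apply/andP; split; lra.
Qed.

Lemma circle_dist_le1 (x y : circle R) : circle_dist x y <= 1.
Proof.
have [u /andP[? ?] <-] := circle_pi_unit x; have [v /andP[? ?] <-] := circle_pi_unit y.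
by rewrite (le_trans (circle_dist_le _ _))// ler_norml; apply/andP; split; lra.
Qed.

Lemma circle_dist_le_diam (U : set (circle R)) x y : U x -> U y ->
  circle_dist x y <= circle_diam U.
Proof.
move=> Ux Uy; apply: ub_le_sup; last by exists x => //; exists y.
by exists 1 => _ [z _ [w _ <-]]; exact: circle_dist_le1.
Qed.

Lemma circle_diam_ge0 (U : set (circle R)) : 0 <= circle_diam U.
Proof.
have [->|/set0P[x Ux]] := eqVneq U set0.
  rewrite /circle_diam (_ : [set _ | _ in _ & _ in _] = set0) ?sup0//.
  by apply/seteqP; split => // z [x []].
apply: le_trans (circle_dist_le_diam Ux Ux).
apply: lb_le_inf; last by move=> _ [s [t [_ _ ->]]].
by exists 0, (repr x), (repr x); rewrite subrr normr0; split => //; exact: circle_pi_repr.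
Qed.

Lemma circle_diam_image_le (U : set R) (w : R) : 0 <= w ->
  (forall u v, U u -> U v -> `|u - v| <= w) -> circle_diam (@circle_pi R @` U) <= w.
Proof.
move=> w0 hU; rewrite /circle_diam; set S := [set _ | _ in _ & _ in _].
have [->|/set0P S0] := eqVneq S set0; first by rewrite sup0.
apply: ge_sup => // _ [_ [u Uu <-] [_ [v Uv <-] <-]].
by rewrite (le_trans (circle_dist_le _ _))// hU.
Qed.

End CircleDistance.

Section Dimension.
Context {R : realType}.
Variables (n : nat) (p c : 'I_n -> R) (g : 'I_n -> circle R -> circle R).
Variables (F : 'I_n -> R -> R) (a b s q : R).
Hypotheses (ab : a < b < a + 2^-1).
Hypotheses (p0 : forall i, 0 < p i) (p1 : \sum_i p i = 1).
Hypotheses (dF : forall i, line_diffeo (F i)).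
Hypotheses (gF : forall i, is_lift (g i) (F i)).
Hypotheses (gK : forall i, exists h, [/\ continuous h, cancel (g i) h & cancel h (g i)]).
Hypotheses (FI : forall i u, a <= u <= b -> a <= F i u <= b).
Hypotheses (Fdisj : forall i j u v, a <= u <= b -> a <= v <= b ->
  F i u = F j v -> i = j).
Hypotheses (Flow : forall i u v, a <= u <= b -> a <= v <= b ->
  c i * `|u - v| <= `|F i u - F i v|).
Hypotheses (s0 : 0 < s) (c0 : forall i, 0 < c i) (pc : forall i, p i <= c i `^ s).
Hypotheses (q0 : 0 < q) (pq : forall i, p i <= q) (q1 : q < 1).

Local Notation arc := (arc a b).

(** The images of [[a, b]] are finitely many disjoint compact intervals. *)
Lemma images_separated : exists2 e : R, 0 < e & forall i j u v, i != j ->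
  a <= u <= b -> a <= v <= b -> e <= `|F i u - F j v|.
Proof.
have /andP[ab1 _] := ab.
have aI : a <= a <= b by rewrite lexx ltW.
have bI : a <= b <= b by rewrite lexx ltW.
have order i j : i != j -> F i a <= F j a -> F i b < F j a.
  move=> ij h; rewrite ltNge; apply/negP => h'.
  have [||u] := @IVT R (F i) a b (F j a) (ltW ab1).
  - by apply: continuous_subspaceT; exact: line_diffeo_continuous.
  - by rewrite ge_min le_max h h' orbT.
  rewrite in_itv /= => uI e; move: ij; apply/negP/negPn/eqP.
  exact: (Fdisj uI aI e).
have one i j : exists e : R, 0 < e /\ (i != j -> forall u v,
    a <= u <= b -> a <= v <= b -> e <= `|F i u - F j v|).
  have [->|ij] := eqVneq i j; first by exists 1.
  have sep k l : k != l -> F k a <= F l a -> 0 < F l a - F k b /\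
      forall u v, a <= u <= b -> a <= v <= b -> F l a - F k b <= `|F k u - F l v|.
    move=> kl h; have := order k l kl h; rewrite -subr_gt0 => h'; split => // u v.
    move=> /andP[u1 u2] /andP[v1 v2].
    have : F k u <= F k b by rewrite line_diffeo_le.
    have : F l a <= F l v by rewrite line_diffeo_le.
    by move=> ? ?; rewrite distrC ger0_norm; lra.
  have [h|/ltW h] := leP (F i a) (F j a).
    by have [h1 h2] := sep i j ij h; exists (F j a - F i b).
  have ji : j != i by rewrite eq_sym.
  have [h1 h2] := sep j i ji h.
  by exists (F i a - F j b); split => // _ u v uI vI; rewrite distrC; exact: h2.
have /choice[e1 he1] : forall i, exists e : R, 0 < e /\ (forall j, i != j -> forall u v,
    a <= u <= b -> a <= v <= b -> e <= `|F i u - F j v|).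
  move=> i; have /choice[e he] := one i.
  have [e' e'0 he'] := finite_pos_lower_bound (fun j => (he j).1).
  exists e'; split => // j ij u v uI vI; apply: (le_trans (he' j)).
  exact: (he j).2.
have [e e0 he] := finite_pos_lower_bound (fun i => (he1 i).1).
exists e => // i j u v ij uI vI; apply: (le_trans (he i)).
exact: (he1 i).2.
Qed.

Section Measure.
Variable nu : probability (borel_circle R) R.
Hypotheses (st : weighted_stationary p g nu) (nu1 : nu arc = 1%E).

(** A set of width [w < e] meets at most one of the images of the arc under the
    [g i].  Pulling it back by that branch multiplies its width by at most [(c i)^-1]
    and its mass by [(p i)^-1]; since [p i <= c i `^ s] the induction on [m]
    preserves the bound [(w / e) `^ s].  After [m] steps without reaching width [e],
    which always happens for a set of width 0, the mass is at most [q ^+ m].  The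
    set need not be measurable, so the estimate is about a measurable [V] that
    contains it. *)
Lemma stationary_small_sets (e : R) : 0 < e ->
  (forall i j u v, i != j -> a <= u <= b -> a <= v <= b -> e <= `|F i u - F j v|) ->
  forall (m : nat) (U : set (circle R)) (w : R), 0 <= w ->
    (forall u v, a <= u <= b -> a <= v <= b -> U (circle_pi u) -> U (circle_pi v) ->
      `|u - v| <= w) ->
    exists V : set (borel_circle R), [/\ measurable V, U `<=` V &
      (nu V <= (Num.max ((w / e) `^ s) (q ^+ m))%:E)%E].
Proof.
move=> e0 sep; have mK : measurable (arc : set (borel_circle R)) by exact: measurable_arc ab.
have mpre h (A : set (borel_circle R)) : continuous h -> measurable A ->
    measurable (h @^-1` A : set (borel_circle R)).
  by move=> ch; exact: measurable_continuous_preimage.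
have big (U : set (circle R)) (r : R) : 1 <= r -> exists V : set (borel_circle R),
    [/\ measurable V, U `<=` V & (nu V <= r%:E)%E].
  move=> r1; exists setT; split => //.
  by rewrite probability_setT lee_fin.
elim=> [|m IH] U w w0 Uw; first by apply: big; rewrite expr0 le_max lexx orbT.
have [ew|we] := leP e w.
  apply: big; rewrite le_max; apply/orP; left.
  have one : 1 `^ s = 1 :> R by rewrite powR1.
  by rewrite -[leLHS]one ge0_ler_powR ?nnegrE ?(ltW s0) ?divr_ge0 ?(ltW e0)// ler_pdivlMr// mul1r.
pose V0 : set (borel_circle R) := ~` (\bigcup_i (g i @` arc)).
have mim i (A : set (borel_circle R)) : measurable A -> measurable (g i @` A : set (borel_circle R)).
  have [h [ch gh hg]] := gK i.
  rewrite (_ : g i @` A = h @^-1` A) => [|]; first exact: mpre.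
  apply/seteqP; split => [_ [x Ax <-]|x Ax]; first by rewrite /preimage /= gh.
  by exists (h x).
have mV0 : measurable V0.
  apply: measurableC; apply: fin_bigcup_measurable => [|i _]; [exact: finite_finset|exact: mim].
have nV0 : nu V0 = 0%E.
  apply: (null_off_images ab gF st nu1) => // i x Kx; apply; exists i => //.
have max0 (r : R) (k : nat) : 0 <= Num.max (r `^ s) (q ^+ k).
  by rewrite le_max powR_ge0.
have [[i [y [Ky Uy]]]|none] := pselect (exists i y, arc y /\ U (g i y)); last first.
  exists V0; split => //; last by rewrite nV0 lee_fin.
  by move=> x Ux [i _ [y Ky yx]]; apply: none; exists i, y; rewrite yx.
have [h [ch gh hg]] := gK i.
have ciw : 0 <= w / c i by rewrite divr_ge0 ?(ltW (c0 i)).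
have [|V' [mV' UV' nuV']] := IH (g i @^-1` U) (w / c i) ciw.
  move=> u v uI vI; rewrite /preimage /= -!(gF i).2 => Uu Uv.
  rewrite ler_pdivlMr// mulrC (le_trans (Flow i uI vI))//.
  by apply: Uw => //; exact: FI.
pose V1 : set (borel_circle R) := h @^-1` (V' `&` arc).
have mV1 : measurable V1 by apply: mpre => //; exact: measurableI.
exists (V0 `|` V1); split; first exact: measurableU.
  move=> x Ux; have [[j _ [z Kz zx]]|nx] := pselect ((\bigcup_i (g i @` arc)) x); last by left.
  have [ij|ij] := eqVneq i j.
    right; rewrite /V1 /preimage /= -zx -ij gh; split => //.
    by apply: UV'; rewrite /preimage /= ij zx.
  exfalso; move: Ky Kz => [u + uy] [v + vz]; rewrite /= !in_itv /= => uI vI.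
  have := sep i j u v ij uI vI; rewrite leNgt => /negP; apply.
  apply: le_lt_trans we; apply: Uw; rewrite ?FI//.
    by rewrite (gF i).2 uy.
  by rewrite (gF j).2 vz zx.
have nuV1 : (nu V1 <= (p i)%:E * nu V')%E.
  rewrite (st mV1) (bigD1 i)//= big1 ?adde0 => [|j ji].
    apply: lee_wpmul2l; first by rewrite lee_fin ltW.
    apply: le_measure; rewrite ?inE//.
      by apply: measurable_continuous_preimage mV1; exact: g_continuous gF i.
    by move=> x; rewrite /V1 /preimage /= gh => -[].
  rewrite (null_off_arc ab nu1) ?mule0//.
    by apply: measurable_continuous_preimage mV1; exact: g_continuous gF j.
  move=> x [u + ux]; rewrite /= in_itv /= => uI; rewrite /V1 /preimage /= => -[_ [v +]].
  rewrite /= in_itv /= => vI /(congr1 (g i)); rewrite hg -ux -!((gF _).2).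
  move=> /(arc_inj ab (FI i vI) (FI j uI)) /(Fdisj vI uI) ij.
  by rewrite ij eqxx in ji.
have le01 : (nu (V0 `|` V1) <= (p i)%:E * nu V')%E.
  have U2 : (nu (V0 `|` V1) <= nu V0 + nu V1)%E by apply: measureU2.
  by rewrite (le_trans U2)// nV0 add0e.
apply: (le_trans le01).
apply: (@le_trans _ _ ((p i)%:E * (Num.max ((w / c i / e) `^ s) (q ^+ m))%:E)%E).
  by apply: lee_wpmul2l => //; rewrite lee_fin ltW.
rewrite -EFinM lee_fin (maxr_pMr _ _ (ltW (p0 i))) ge_max !le_max; apply/andP; split.
  apply/orP; left; have -> : w / e = c i * (w / c i / e) by field; rewrite !gt_eqF.
  have [ci0 we0] : 0 <= c i /\ 0 <= w / c i / e by split; [exact: ltW|rewrite divr_ge0// ltW].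
  by rewrite [leRHS]powRM//; apply: ler_wpM2r => //; exact: powR_ge0.
by apply/orP; right; rewrite exprS; apply: ler_wpM2r => //; rewrite exprn_ge0 ?ltW.
Qed.

(** Mass distribution principle: in a cover with small [t]-sum, [t < s], the masses
    add up to at most a small multiple of that sum, plus a summable error from the
    bound [q ^+ m], whose exponent is chosen for each set of the cover. *)
Lemma stationary_dim_ge : (s%:E <= hausdorff_dim_measure nu)%E.
Proof.
have [e e0 sep] := images_separated.
apply: le_ereal_inf_tmp => _ [E [mE nuE] <-].
apply: le_ereal_inf_tmp => _ [t [t0 Ht] <-]; rewrite lee_fin leNgt; apply/negP => ts.
have fE : nu E \is a fin_num by rewrite fin_num_measure.
pose x := fine (nu E).
have x0 : 0 < x by apply: fine_gt0; rewrite nuE ltey_eq fE.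
pose C := (e^-1) `^ s; have C0 : 0 < C by rewrite powR_gt0// invr_gt0.
have Hsmall : (hausdorff_premeasure t 1 E < (x / (2 * C))%:E)%E.
  apply: (@le_lt_trans _ _ 0%E); last by rewrite lte_fin divr_gt0// mulr_gt0.
  apply: (@le_trans _ _ (hausdorff_measure t E)); last by rewrite Ht.
  by apply: ereal_sup_ubound; exists 1 => //=; exact: ltr01.
have [_ [U [Ud EU] <-] Usum] := ereal_inf_lt Hsmall.
have /choice[V hV] : forall i, exists V : set (borel_circle R), [/\ measurable V, U i `<=` V &
    (nu V <= (C * circle_diam (U i) `^ t)%:E + (x / 4 / (2 ^ i.+1)%:R)%:E)%E].
  move=> i.
  have [m qm] : exists m, q ^+ m <= x / 4 / (2 ^ i.+1)%:R.
    have d0 : 0 < x / 4 / (2 ^ i.+1)%:R by rewrite !divr_gt0// ltr0n expn_gt0.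
    have /cvgrPdist_lt/(_ _ d0)[N _ hN] : (fun m => q ^+ m) @ \oo --> (0 : R).
      by apply: cvg_expr; rewrite gtr0_norm.
    exists N; have := hN N (leqnn N); rewrite /= sub0r normrN.
    by move=> /ltW; rewrite ger0_norm// exprn_ge0 ?ltW.
  have [|V [mV UV nuV]] := stationary_small_sets e0 sep m (U := U i) (circle_diam_ge0 (U i)).
    move=> u v /andP[u1 u2] /andP[v1 v2] Uu Uv.
    apply: le_trans (circle_dist_le_diam Uu Uv); apply: circle_dist_ge.
    by have /andP[_ ab2] := ab; rewrite ler_norml; apply/andP; split; lra.
  exists V; split => //; apply: (le_trans nuV); rewrite -EFinD lee_fin ge_max; apply/andP; split.
    rewrite powRM ?circle_diam_ge0 ?invr_ge0 ?(ltW e0)// -/C mulrC.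
    rewrite -[leLHS]addr0 lerD//; last first.
      by rewrite (le_trans _ qm)// exprn_ge0// ltW.
    rewrite ler_pM2l//.
    have [d0|d0] := eqVneq (circle_diam (U i)) 0.
      by rewrite d0 !powR0 ?gt_eqF.
    apply: ger_powR; last exact: ltW.
    by rewrite Ud andbT lt_neqAle eq_sym d0 circle_diam_ge0.
  by rewrite -[leLHS]add0r lerD// mulr_ge0 ?powR_ge0// ltW.
have nuE_le : (nu E <= \sum_(0 <= i <oo) nu (V i))%E.
  apply: measure_sigma_subadditive => //; first by move=> i; have [] := hV i.
  by move=> y /EU[i _ Uiy]; exists i => //; have [_ + _] := hV i; apply.
have : (nu E <= C%:E * (x / (2 * C))%:E + (x / 4)%:E)%E.
  apply: (le_trans nuE_le).
  apply: (@le_trans _ _ (\sum_(0 <= i <oo) ((C * circle_diam (U i) `^ t)%:E +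
      (x / 4 / (2 ^ i.+1)%:R)%:E))%E).
    by apply: lee_nneseries => [i _ _|i _]; [exact: measure_ge0|have [_ _] := hV i].
  have x4 : 0 <= x / 4 by rewrite divr_ge0// ltW.
  apply: le_trans (epsilon_trick _ _ x4) _.
    by move=> i; rewrite lee_fin mulr_ge0 ?powR_ge0// ltW.
  rewrite leeD2r//.
  under eq_eseriesr do rewrite EFinM.
  rewrite nneseriesZl; last by move=> i _; rewrite lee_fin powR_ge0.
  by apply: lee_wpmul2l; [rewrite lee_fin ltW|exact: ltW].
rewrite -(fineK fE) -/x -EFinM -EFinD lee_fin.
have -> : C * (x / (2 * C)) = x / 2 by field; rewrite gt_eqF.
by lra.
Qed.

End Measure.
End Dimension.

(** * Comparison of the dimensions *)

Section Conclusion.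
Context {R : realType}.

(** If all partial sums of the [w k `^ s] were bounded, then those of the
    [w k `^ s'] would be at most [d `^ (s' - s)] times that bound, which is small for
    fine covers; but the [s']-dimensional Hausdorff measure is not zero. *)
Lemma hausdorff_large_covers (A : set (circle R)) (s s' : R) : 0 < s -> s < s' ->
  hausdorff_measure s' A <> 0%E -> large_covers (@circle_pi R @^-1` A) s.
Proof.
move=> s0 ss' HA T.
have pre0 (d : R) : (0 <= hausdorff_premeasure s' d A)%E.
  by apply: le_ereal_inf_tmp => _ [U _ <-]; apply: nneseries_ge0 => i _ _; rewrite lee_fin powR_ge0.
have [d0 d00 [c c0 hc]] : exists2 d0 : R, 0 < d0 &
    exists2 c : R, 0 < c & (c%:E <= hausdorff_premeasure s' d0 A)%E.
  have [[d0 [d00 hd0]]|none] := pselect (exists d0 : R, 0 < d0 /\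
      (0 < hausdorff_premeasure s' d0 A)%E).
    exists d0 => //; move: hd0; case: (hausdorff_premeasure s' d0 A) => [r||//].
      by rewrite lte_fin => r0; exists r.
    by move=> _; exists 1 => //; rewrite leey.
  exfalso; apply: HA; apply/eqP; rewrite eq_le; apply/andP; split.
    apply: ge_ereal_sup => _ [d d0 <-]; rewrite leNgt; apply/negP => h.
    by apply: none; exists d.
  apply: (le_trans (pre0 1)); apply: ereal_sup_ubound.
  by exists 1 => //=; exact: ltr01.
pose T1 := Num.max T 1; have T10 : 0 < T1 by rewrite lt_max ltr01 orbT.
have r0 : 0 < s' - s by rewrite subr_gt0.
pose d1 := (c / (2 * T1)) `^ (s' - s)^-1.
have x0 : 0 < c / (2 * T1) by rewrite divr_gt0// mulr_gt0.
have d10 : 0 < d1 by exact: powR_gt0.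
have d1E : d1 `^ (s' - s) * T1 = c / 2.
  rewrite /d1 -powRrM mulVf ?gt_eqF// powRr1 ?ltW//.
  by field; rewrite gt_eqF.
exists (Num.min d0 d1); first by rewrite lt_min d00.
move=> U w hw hU; apply: contrapT => none.
have part n : \sum_(k < n) w k `^ s < T1.
  have h : \sum_(k < n) w k `^ s < T.
    by rewrite ltNge; apply/negP => h; apply: none; exists n.
  by apply: (lt_le_trans h); rewrite le_max lexx.
have w0 k : 0 <= w k by have [/andP[]] := hw k.
have diam k : circle_diam (@circle_pi R @` U k) <= w k.
  by apply: circle_diam_image_le => //; have [_] := hw k.
have : (c%:E <= (c / 2)%:E)%E; last by rewrite lee_fin; lra.
apply: (le_trans hc).
apply: (@le_trans _ _ (\sum_(0 <= k <oo) (circle_diam (@circle_pi R @` U k) `^ s')%:E)%E).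
  apply: ereal_inf_lbound; exists (fun k => @circle_pi R @` U k) => //; split.
    move=> k; apply: (le_trans (diam k)).
    by have [/andP[_]] := hw k; rewrite le_min => /andP[].
  move=> x Ax; have [t t01 tx] := circle_pi_unit x.
  have [|k Uk] := hU t _ t01; first by rewrite /preimage /= tx.
  by exists k => //; exists t.
apply: lime_le; first by apply: is_cvg_nneseries => k _ _; rewrite lee_fin powR_ge0.
apply: nearW => n; rewrite sumEFin lee_fin big_mkord -d1E.
apply: (@le_trans _ _ (\sum_(k < n) d1 `^ (s' - s) * w k `^ s)); last first.
  by rewrite -mulr_sumr ler_wpM2l ?powR_ge0// ltW.
apply: ler_sum => k _.
apply: (@le_trans _ _ (w k `^ s')).
  by apply: ge0_ler_powR; rewrite ?nnegrE ?circle_diam_ge0//; lra.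
have [->|wk] := eqVneq (w k) 0; first by rewrite !powR0 ?mulr0// gt_eqF//; lra.
have -> : w k `^ s' = w k `^ (s' - s) * w k `^ s.
  by rewrite -powRD ?wk ?implybT// subrK.
apply: ler_wpM2r; first exact: powR_ge0.
apply: ge0_ler_powR; rewrite ?nnegrE ?(ltW d10)//; first exact: ltW.
by have [/andP[_]] := hw k; rewrite le_min => /andP[].
Qed.

Section FiniteFamily.
Variables (G : set (circle R -> circle R)) (n : nat) (p : 'I_n -> R).
Variable g : 'I_n -> circle R -> circle R.
Hypotheses (Gg : forall i, G (g i)) (ginj : injective g).

(** The push-forward of the weights, where equality of circle maps is decided
    classically. *)
Definition family_mass (f : circle R -> circle R) : R := \sum_(i | `[< g i = f >]) p i.

Lemma family_massE i : family_mass (g i) = p i.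
Proof.
rewrite /family_mass (big_pred1 i)// => j; apply/asboolP/eqP => [/ginj|->//].
by [].
Qed.

Lemma family_mass0 f : (forall i, g i <> f) -> family_mass f = 0.
Proof. by move=> h; rewrite /family_mass big1// => i /asboolP/h. Qed.

Lemma fsbig_family (V : Type) (idx : V) (op : Monoid.com_law idx)
    (Y : (circle R -> circle R) -> V) : (forall f, (forall i, g i <> f) -> Y f = idx) ->
  \big[op/idx]_(f \in G) Y f = \big[op/idx]_(i < n) Y (g i).
Proof.
move=> Y0; rewrite (fsbigE [seq g i | i <- index_enum 'I_n]).
- rewrite big_map; apply: eq_bigl => i; exact/asboolP.
- by rewrite map_inj_uniq// index_enum_uniq.
- by move=> _ /= /mapP[i _ ->].
- move=> f _ h; apply: Y0 => i gif; move/negP: h; apply.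
  by rewrite -gif; apply: map_f; rewrite mem_index_enum.
Qed.

Lemma family_mass_probability : (forall i, 0 <= p i) -> \sum_i p i = 1 ->
  finitely_supported_probability G family_mass.
Proof.
move=> p0 p1; have supp f : family_mass f != 0 -> exists i, g i = f.
  move=> h; apply: contrapT => none; move/eqP: h; apply.
  by apply: family_mass0 => i gif; apply: none; exists i.
split.
- by move=> f; apply: sumr_ge0.
- apply: (@sub_finite_set _ _ (range g)); last exact: finite_image.
  by move=> f /supp[i gif]; exists i.
- by move=> f /supp[i <-].
- rewrite fsbig_family => [|f]; last exact: family_mass0.
  by under eq_bigr do rewrite family_massE.
Qed.

Lemma family_mass_stationary nu :
  stationary G family_mass nu <-> weighted_stationary p g nu.
Proof.
have e (A : set (borel_circle R)) : (\sum_(f \in G) (family_mass f)%:E *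
    pushforward nu (f : borel_circle R -> borel_circle R) A =
    \sum_(i < n) (p i)%:E * nu (g i @^-1` A))%E.
  rewrite fsbig_family => [|f /family_mass0 ->]; last by rewrite mul0e.
  by apply: eq_bigr => i _; rewrite family_massE.
by split => st A mA; rewrite st// e.
Qed.

End FiniteFamily.

Lemma probability_full_component (nu nu1 nu2 : probability (borel_circle R) R)
    (t : R) (A : set (borel_circle R)) : measurable A -> 0 < t < 1 ->
  (forall B : set (borel_circle R), measurable B ->
    nu B = (t%:E * nu1 B + (1 - t)%:E * nu2 B)%E) ->
  nu A = 1%E -> nu1 A = 1%E /\ nu2 A = 1%E.
Proof.
move=> mA /andP[t0 t1] hnu nuA.
have := hnu _ mA; rewrite nuA.
have := probability_le1 nu1 mA; have := probability_le1 nu2 mA.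
rewrite -(fineK (fin_num_measure nu1 A mA)) -(fineK (fin_num_measure nu2 A mA)).
rewrite -!EFinM -EFinD !lee_fin => y1 x1 [].
by move=> e; split; congr (_%:E); nra.
Qed.

Section Group.
Variables (G : set (circle R -> circle R)) (L : set (circle R)).
Hypotheses (GD : G `<=` @Diff2_plus R) (grG : is_group G) (Lmin : minimal_set G L).
Hypothesis star : forall x, L x -> NE G x -> isolated_fixed G x.

(** The weights [p i] proportional to [c i `^ s] satisfy [p i <= c i `^ s] by
    [system_sum], so that the stationary measure on the arc has dimension at least
    [s].  It is ergodic because the components of a convex decomposition also live
    on the arc, where stationary measures are unique. *)
Lemma stationary_of_large_dim (s : R) : 0 < s -> large_covers (@circle_pi R @^-1` L) s ->
  exists nu : probability (borel_circle R) R, [/\ nu L = 1%E,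
    exists mu, finitely_supported_probability G mu /\ ergodic_stationary G mu nu &
    (s%:E <= hausdorff_dim_measure nu)%E].
Proof.
move=> s0 hL; have DG := lifts_group GD grG.
have [|a [b [n [F [c sys]]]]] := exists_contracting_system DG
    (fun F t => lift_invariant grG Lmin (F := F) (t := t)) (lift_closed Lmin)
    (fun t Lt => lift_locally_expandable GD (star Lt))
    (fun x y e => orbit_dense GD grG Lmin (s := x) (t := y) (e := e)) s0 hL.
  have [[x Lx] _ _ _] := Lmin.
  by exists (repr x); rewrite /preimage /= circle_pi_repr.
have [ab [z Lz zab] DF FI Fdisj Flow Fup c0 csum] := sys.
have /choice[g hg] : forall i, exists g, G g /\ is_lift g (F i).
  by move=> i; have [g Gg gF] := DF i; exists g.
have Gg i : G (g i) := (hg i).1.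
have gF i : is_lift (g i) (F i) := (hg i).2.
have dF i : line_diffeo (F i) by exact: lift_group_diffeo DG _ (DF i).
have /andP[ab1 _] := ab.
have aI : a <= a <= b by rewrite lexx ltW.
have bI : a <= b <= b by rewrite lexx ltW.
have ginj : injective g.
  move=> i j gij; apply: (Fdisj i j a a) => //.
  by apply: (arc_inj ab); [exact: FI|exact: FI|rewrite !(gF _).2 gij].
pose S := \sum_i c i `^ s; have S0 : 0 < S by exact: lt_le_trans csum.
pose p i := c i `^ s / S.
have p0 i : 0 < p i by rewrite divr_gt0// powR_gt0.
have p1 : \sum_i p i = 1 by rewrite /p -mulr_suml divff// gt_eqF.
have pc i : p i <= c i `^ s by rewrite ler_pdivrMr// ler_peMr ?powR_ge0.
have c2 i : c i <= 2^-1.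
  have ba : 0 < `|b - a| by rewrite normr_gt0 subr_eq0 gt_eqF.
  by rewrite -(ler_pM2r ba) (le_trans (Flow i _ _ bI aI))// Fup.
pose q : R := 2^-1 `^ s.
have q0 : 0 < q by rewrite powR_gt0// invr_gt0.
have q1 : q < 1.
  have -> : 1 = 1 `^ s :> R by rewrite powR1.
  by apply: gt0_ltr_powR; rewrite ?nnegrE//; lra.
have pq i : p i <= q.
  rewrite (le_trans (pc i))//; apply: ge0_ler_powR; rewrite ?nnegrE//; exact: ltW.
have [_ cL /(invariant_setP grG) Linv _] := Lmin.
have meets : L `&` arc a b !=set0.
  by exists (circle_pi z); split => //; exists z => //=; rewrite in_itv.
have [nu [st nu1 nuL]] := exists_weighted_stationary p0 p1 gF FI Fup cL
  (fun i x => Linv _ x (Gg i)) meets.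
exists nu; split => //.
  exists (family_mass p g); split.
    by apply: family_mass_probability => // i; exact: ltW.
  split; first exact/family_mass_stationary.
  move=> nu' nu'' t /family_mass_stationary st' /family_mass_stationary st'' t01 e A mA.
  have mK := measurable_arc ab.
  have [h1 h2] := probability_full_component mK t01 e nu1.
  by apply: (weighted_stationary_unique ab p0 gF FI Fup (st' _ _) (st'' _ _)).
apply: (stationary_dim_ge ab p0 dF gF _ FI Fdisj Flow s0 c0 pc q0 pq q1 st nu1).
move=> i; have [_ _ Ginv] := grG; have [h [Gh gh hg']] := Ginv _ (Gg i).
by exists h; split; [exact: (group_continuous GD Gh)|exact: gh|exact: hg'].
Qed.

End Group.

Lemma hausdorff_dim_ge0 (A : set (circle R)) : (0 <= hausdorff_dim A)%E.
Proof. by apply: le_ereal_inf_tmp => _ [s [s0 _] <-]; rewrite lee_fin ltW. Qed.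

Lemma hausdorff_dim_measure_le (nu : probability (borel_circle R) R)
  (A : set (borel_circle R)) : measurable A -> nu A = 1%E ->
  (hausdorff_dim_measure nu <= hausdorff_dim A)%E.
Proof.
by move=> mA nuA; apply: ereal_inf_lbound; exists A => //; split => //; rewrite nuA lte01.
Qed.

End Conclusion.
Section Dirac.
Context {R : realType}.

(** For the trivial measure [mu] on the identity every probability is stationary, and
    the ergodic ones are the extreme points among all probabilities.  This shows
    that the supremum is over a nonempty set, which matters in dimension 0. *)
Lemma dirac_ergodic (G : set (circle R -> circle R)) (L : set (circle R)) :
  is_group G -> closed L -> L !=set0 ->
  exists nu : probability (borel_circle R) R, nu L = 1%E /\
    exists mu, finitely_supported_probability G mu /\ ergodic_stationary G mu nu.
Proof.
move=> [Gid _ _] cL [x Lx]; have mL := closed_measurable_circle cL.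
pose p (i : 'I_1) : R := 1; pose g (i : 'I_1) : circle R -> circle R := id.
have ginj : injective g by move=> i j _; rewrite [i]ord1 [j]ord1.
have p1 : \sum_i p i = 1 by rewrite big_ord1.
exists (@dirac _ (borel_circle R) x R : probability (borel_circle R) R).
split; first by rewrite /= diracE mem_set.
exists (family_mass p g); split.
  by apply: family_mass_probability => // i; rewrite ler01.
split.
  apply/family_mass_stationary => // A mA.
  by rewrite big_ord1 mul1e.
move=> nu1 nu2 t _ _ t01 e A mA.
have [Ax|nAx] := pselect (A x).
  by have [|-> ->] := probability_full_component mA t01 e; first by rewrite /= diracE mem_set.
have mC := measurableC mA.
have [|] := probability_full_component mC t01 e; first by rewrite /= diracE mem_set.
rewrite !probability_setC//.
rewrite -(fineK (fin_num_measure nu1 A mA)) -(fineK (fin_num_measure nu2 A mA)).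
by rewrite -!EFinB => -[e1] [e2]; congr (_%:E); lra.
Qed.

End Dirac.

Theorem theorem2p14 (R : realType) (G : set (circle R -> circle R))
    (Lambda : set (circle R)) :
  G `<=` @Diff2_plus R ->
  is_group G ->
  finitely_generated G ->
  ~ preserves_probability G ->
  property_star G \/ property_Lambda_star G ->
  minimal_set G Lambda ->
  hausdorff_dim Lambda =
    ereal_sup [set hausdorff_dim_measure nu |
      nu in [set nu : probability (borel_circle R) R |
        nu Lambda = 1%E /\
        exists mu : (circle R -> circle R) -> R,
          finitely_supported_probability G mu /\ ergodic_stationary G mu nu]].
Proof.
move=> GD grG _ _ star Lmin; have [L0 cL _ _] := Lmin.
have mL := closed_measurable_circle cL.
set S := ereal_sup _; apply/eqP; rewrite eq_le; apply/andP; split; last first.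
  by apply: ge_ereal_sup => _ [nu [nuL _] <-]; exact: hausdorff_dim_measure_le.
have S0 : (0 <= S)%E.
  have [nu nuP] := dirac_ergodic grG cL L0.
  apply: (@le_trans _ _ (hausdorff_dim_measure nu)).
    by apply: le_ereal_inf_tmp => _ [E _ <-]; exact: hausdorff_dim_ge0.
  by apply: ereal_sup_ubound; exists nu.
rewrite leNgt; apply/negP => lt.
have [s [s' [s0 ss' Ss s'dim]]] : exists s s' : R,
    [/\ 0 < s, s < s', (S < s%:E)%E & (s'%:E < hausdorff_dim Lambda)%E].
  move: (S) S0 lt => [r||//]; last first.
    by move=> _; rewrite ltNge leey.
  rewrite lee_fin => r0; case: (hausdorff_dim Lambda) => [d||//].
    rewrite lte_fin => rd; exists ((r + r + d) / 3), ((r + d + d) / 3).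
    by rewrite !lte_fin; split; lra.
  by move=> _; exists (r + 1), (r + 2); rewrite !lte_fin ltry; split => //; lra.
have Hs' : hausdorff_measure s' Lambda <> 0%E.
  move=> H; move: s'dim; rewrite ltNge => /negP; apply; apply: ereal_inf_lbound.
  by exists s' => //; split => //; exact: lt_trans ss'.
have [nu [nuL muP snu]] := stationary_of_large_dim GD grG Lmin
  (fun x => star_on_minimal_set GD grG star Lmin (x := x)) s0
  (hausdorff_large_covers s0 ss' Hs').
move: Ss; rewrite ltNge => /negP; apply; apply: (le_trans snu).
by apply: ereal_sup_ubound; exists nu.
Qed.
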